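(* For every integer $t\ge2$, $\operatorname{reg}(\mathbb{K}[G_t])=4$ and $\deg h_{\mathbb{K}[G_t]}(x)=t+3$.
   Context: $\mathbb{K}$ is an algebraically closed field of characteristic zero. For $t\ge2$, $G_t$ is the graph with vertex set $\{x_1,x_2,y_1,\dots,y_t,z_1,z_2,w_1,w_2\}$ and edges $a_i=\{x_1,y_i\}$, $b_i=\{x_2,y_i\}$ ($1\le i\le t$), $e_1=\{x_1,z_1\}$, $e_2=\{z_1,z_2\}$, $e_3=\{z_2,x_1\}$, $f_1=\{x_2,w_1\}$, $f_2=\{w_1,w_2\}$, $f_3=\{w_2,x_2\}$. Its toric ideal $I_{G_t}$ is the kernel of the $\mathbb{K}$-algebra map from the standard graded ring $\mathbb{K}[E_t]=\mathbb{K}[a_1,\dots,a_t,f_1,f_2,f_3,e_1,e_2,e_3,b_1,\dots,b_t]$ to the polynomial ring on the vertices sending each edge variable to the product of its two endpoints, and $\mathbb{K}[G_t]=\mathbb{K}[E_t]/I_{G_t}$. $\operatorname{reg}$ is Castelnuovo–Mumford regularity; $h_{\mathbb{K}[G_t]}(x)$ is the $h$-polynomial, i.e. $HS_{\mathbb{K}[G_t]}(x)=h(x)/(1-x)^{\dim\mathbb{K}[G_t]}$ with $h(1)\neq0$. *)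

(* Defs.v *)
From HB Require Import structures.
From mathcomp Require Import all_boot all_algebra.
Set Implicit Arguments. Unset Strict Implicit. Unset Printing Implicit Defensive.
Import GRing.Theory.
Local Open Scope ring_scope.

(* A homogeneous polynomial of degree d in n variables is identified  *)
(* with its coefficient row vector indexed by the finite type of      *)
(* monomials (exponent vectors) of total degree d.                    *)
Definition mon (n d : nat) : finType :=
  {m : {ffun 'I_n -> 'I_d.+1} | (\sum_(i < n) (m i : nat))%N == d}.

Definition fmx (K : nzRingType) (A B : finType) (f : A -> B -> K)
  : 'M[K]_(#|A|, #|B|) := \matrix_(i, j) f (enum_val i) (enum_val j).

(* A graph on vertices 0..nV-1 with n edges; edge e has endpoints ends e.
   The toric map sends the edge variable e to the product of its two
   endpoint variables; a monomial x^m of degree d in the edge variables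
   is sent to the vertex monomial with exponent vector edge_img ends m. *)
Definition edge_img (n : nat) (ends : nat -> nat * nat) (d : nat)
  (m : mon n d) (v : nat) : nat :=
  (\sum_(e < n) (val m e : nat) * (((ends e).1 == v) + ((ends e).2 == v)))%N.

Definition toric_mx (K : nzRingType) (n nV : nat) (ends : nat -> nat * nat)
  (d : nat) : 'M[K]_(#|mon n d|, #|mon nV (2 * d)|) :=
  fmx (fun (r : mon n d) (c : mon nV (2 * d)) =>
    if [forall v : 'I_nV, (val c v : nat) == edge_img ends r v]
    then (1 : K) else 0).

Definition toric_ideal_deg (K : fieldType) n nV ends d :=
  kermx (toric_mx K n nV ends d).

Definition hilb_fun (K : fieldType) n nV ends (d : nat) : nat :=
  (#|mon n d| - \rank (toric_ideal_deg K n nV ends d))%N.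

(* Koszul complex of K[G] with respect to the edge variables.          *)
(* Homological degree i, internal degree i + d:                        *)
(*   K_i(x; K[E])_{i+d} = /\^i K^n (x) K[E]_d, basis (S, m), #|S| = i.  *)
(* The Koszul complex of K[G] = K[E]/I is this modulo /\^i (x) I_d.    *)
(* Its homology H_i(x; K[G])_{i+d} = Tor_i^{K[E]}(K[G], K)_{i+d} has    *)
(* dimension the graded Betti number beta_{i, i+d}.                    *)
Definition kos (n i d : nat) : finType :=
  ({S : {set 'I_n} | #|S| == i} * mon n d)%type.

Definition koszul_mx (K : nzRingType) (n i d : nat)
  : 'M[K]_(#|kos n i.+1 d|, #|kos n i d.+1|) :=
  fmx (fun (p : kos n i.+1 d) (q : kos n i d.+1) =>
    \sum_(k in val p.1)
      (if (val q.1 == val p.1 :\ k) &&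
          [forall l : 'I_n, (val q.2 l : nat) == (val p.2 l + (l == k))%N]
       then (-1) ^+ #|[set l in val p.1 | (l < k)%N]| else 0)).

Definition kos_ideal_mx (K : fieldType) n nV ends (i d : nat) :=
  fmx (fun (p : {S : {set 'I_n} | #|S| == i} * 'I_#|mon n d|)
           (q : kos n i d) =>
    if p.1 == q.1 then toric_ideal_deg K n nV ends d p.2 (enum_rank q.2)
    else 0).

(* dimension of the cycles of the quotient complex (lifted): preimage of
   /\^{i-1} (x) I under the differential *)
Definition kos_cycles_dim (K : fieldType) n nV ends (i d : nat) : nat :=
  match i with
  | 0 => #|kos n 0 d|
  | i'.+1 => \rank (kermx (koszul_mx K n i' d
                           *m cokermx (kos_ideal_mx K n nV ends i' d.+1)))
  end.

(* dimension of the boundaries of the quotient complex (lifted):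
   image of the differential + /\^i (x) I *)
Definition kos_bound_dim (K : fieldType) n nV ends (i d : nat) : nat :=
  match d with
  | 0 => \rank (kos_ideal_mx K n nV ends i 0)
  | d'.+1 => \rank (koszul_mx K n i d' + kos_ideal_mx K n nV ends i d'.+1)%MS
  end.

Definition betti (K : fieldType) n nV ends (i d : nat) : nat :=
  (kos_cycles_dim K n nV ends i d - kos_bound_dim K n nV ends i d)%N.

Definition reg_eq (K : fieldType) n nV ends (r : nat) : Prop :=
  (exists i, betti K n nV ends i r != 0%N) /\
  (forall i d, betti K n nV ends i d != 0%N -> (d <= r)%N).

(* h-polynomial: HS(x) = h(x)/(1-x)^D with h(1) != 0, i.e. the coefficients
   of h are those of HS(x) (1-x)^D; deg h = s *)
Definition hpoly_deg_eq (K : fieldType) n nV ends (s : nat) : Prop :=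
  exists (D : nat) (h : {poly int}),
    (forall k : nat,
       h`_k = \sum_(l < D.+1 | (l <= k)%N)
                (-1) ^+ l * ('C(D, l))%:Z * (hilb_fun K n nV ends (k - l))%:Z)
    /\ h.[1] != 0 /\ (size h).-1 = s.

(* Vertices: x1=0, x2=1, z1=2, z2=3, w1=4, w2=5, y_i = 5+i (1<=i<=t).  *)
(* Edges (variable order a_1..a_t, f1,f2,f3, e1,e2,e3, b_1..b_t):       *)
(*   k < t : a_{k+1} = {x1, y_{k+1}};  t: f1={x2,w1}; t+1: f2={w1,w2};   *)
(*   t+2: f3={w2,x2}; t+3: e1={x1,z1}; t+4: e2={z1,z2}; t+5: e3={z2,x1}; *)
(*   t+6+j : b_{j+1} = {x2, y_{j+1}}  (0 <= j < t).                     *)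
Definition Gt_nV (t : nat) : nat := (t + 6)%N.
Definition Gt_nE (t : nat) : nat := (2 * t + 6)%N.
Definition Gt_ends (t : nat) (k : nat) : nat * nat :=
  if (k < t)%N then (0%N, (6 + k)%N)
  else if k == t then (1%N, 4%N)
  else if k == (t + 1)%N then (4%N, 5%N)
  else if k == (t + 2)%N then (5%N, 1%N)
  else if k == (t + 3)%N then (0%N, 2%N)
  else if k == (t + 4)%N then (2%N, 3%N)
  else if k == (t + 5)%N then (3%N, 0%N)
  else (1%N, (6 + (k - (t + 6)))%N).

(* Main.v *)
Require Import Defs.
From HB Require Import structures.
From mathcomp Require Import all_boot all_order all_algebra.
From mathcomp Require Import zify ring.
Set Implicit Arguments. Unset Strict Implicit. Unset Printing Implicit Defensive.
Import Order.TTheory GRing.Theory Num.Theory.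
Local Open Scope ring_scope.

(* The toric ideal is generated by the 2x2 minors a_i b_j - a_j b_i and the
   quintics P b_i b_j - Q a_i a_j with P = e1 e3 f2, Q = e2 f1 f3.  We work with
   quotients of K[G_t] by monomial ideals, each given by the set L of degrees
   ("live" elements) where it does not vanish.  For an edge x put
   L1 = {w in L | w - x not in L} and L2 = {w in L | w + x in L}; the sequence
   0 -> L2(-1) -> L -> L1 -> 0 gives reg L <= max (reg L1, reg L2 + 1) and
   H_L = H_L1 + X H_L2, and if x is a nonzerodivisor (L2 = L) then
   reg L <= reg L1 and (1 - X) H_L = H_L1.  Now e1 is a nonzerodivisor; modulo
   e1 the relations are the minors and e2 f1 f3 a_i a_j.  Splitting along e2, f1,
   f3 raises the regularity by one each time, from the Segre ring (al <= |y|) and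
   its quotient by the a_i a_j (al <= 1), both of regularity 1 by splitting along
   the a_i and b_i.  This gives reg <= 4 together with
   h = (1 + X + X^2) (1 + (t - 1) X) + X^3 (2 - (1 - X)^t).
   The bound 4 is attained because a quintic is a minimal generator: its
   multidegree has just two monomials, with disjoint supports. *)

(** * Koszul cycles on live sets *)

(** The part with [l < k] becomes, after exchanging the sums, the negative of the part with [k < l].
    Pairing the terms this way avoids dividing by 2, so the argument holds in any abelian group. *)
Lemma sum_antisym (V : zmodType) n (P : pred 'I_n) (F : 'I_n -> 'I_n -> V) :
  (forall k l, P k -> P l -> k != l -> F l k = - F k l) ->
  \sum_(k | P k) \sum_(l | P l && (k != l)) F k l = 0.
Proof.
move=> FN.
rewrite (eq_bigr (fun k : 'I_n => \sum_(l | P l && (k < l)%N) F k l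
    + \sum_(l | P l && (l < k)%N) F k l)); last first.
  move=> k Pk; rewrite (bigID (fun l : 'I_n => (k < l)%N)) /=; congr (_ + _);
    apply: eq_bigl => l; rewrite -val_eqE /=; lia.
rewrite big_split /= [X in _ + X](exchange_big_dep P) /=; last by move=> k l _ /andP[].
rewrite -big_split /=; apply: big1 => k Pk.
rewrite [X in _ + X](eq_bigl (fun l : 'I_n => P l && (k < l)%N)); last first.
  by move=> l; rewrite Pk.
rewrite -big_split /=; apply: big1 => l /andP[Pl kl].
by rewrite (FN k l) ?subrr // -val_eqE neq_ltn kl.
Qed.

Section Koszul.
Variables (K : comNzRingType) (n : nat) (G : zmodType) (x : 'I_n -> G).
Implicit Types (L : pred G) (c u : {set 'I_n} -> G -> K) (S : {set 'I_n}).

Definition ksign (k : 'I_n) S : K := (-1) ^+ #|[set l in S | (l < k)%N]|.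

(* [c S w] is the coefficient of e_S (x) w in the Koszul complex of the module
   with basis the live elements, on which x_k acts by translation. *)
Definition bd c S (w : G) : K :=
  \sum_(k | k \notin S) ksign k S * c (k |: S) (w - x k).

Definition supp L c := forall S w, ~~ L w -> c S w = 0.

Definition cut L c S w : K := if L w then c S w else 0.

(** Convexity makes the partial translations commute, dead targets counting as zero, so that the
    live elements span a module over the polynomial ring. *)
Definition convex_live L :=
  forall w k l, L w -> L (w + x k + x l) -> L (w + x k).

Lemma ksign_sqr k S : ksign k S * ksign k S = 1.
Proof. by rewrite -expr2 sqrr_sign. Qed.

Lemma ksign0 k : ksign k set0 = 1.
Proof. by rewrite /ksign (eq_card0 (A := [set _ in _ | _])) // => l; rewrite !inE. Qed.

Lemma ksign_setU1 (k l : 'I_n) S : k \notin S ->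
  ksign l (k |: S) = (-1) ^+ (k < l)%N * ksign l S.
Proof.
move=> kS; rewrite /ksign -exprD; congr (_ ^+ _).
have [kl|kl] := boolP (k < l)%N; last first.
  rewrite add0n; apply: eq_card => j; rewrite !inE.
  by case: eqP => //= ->; rewrite (negPf kl) (negPf kS).
rewrite -[RHS]/((true + _)%N) add1n.
have -> : [set j in k |: S | (j < l)%N] = k |: [set j in S | (j < l)%N].
  by apply/setP => j; rewrite !inE; case: eqP => //= ->; rewrite kl.
by rewrite cardsU1 inE (negPf kS).
Qed.

Lemma eq_bd c1 c2 S w :
  (forall k, k \notin S -> c1 (k |: S) (w - x k) = c2 (k |: S) (w - x k)) ->
  bd c1 S w = bd c2 S w.
Proof. by move=> e; apply: eq_bigr => k kS; rewrite e. Qed.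

Lemma bdD c1 c2 S w :
  bd (fun S w => c1 S w + c2 S w) S w = bd c1 S w + bd c2 S w.
Proof. by rewrite -big_split; apply: eq_bigr => k _; rewrite mulrDr. Qed.

Lemma bdB c1 c2 S w :
  bd (fun S w => c1 S w - c2 S w) S w = bd c1 S w - bd c2 S w.
Proof.
rewrite /bd -sumrB; apply: eq_bigr => k _; rewrite mulrBr //.
Qed.

Lemma bd_bd c S w : bd (bd c) S w = 0.
Proof.
pose F k l := ksign k S * (ksign l (k |: S) * c (l |: (k |: S)) (w - x k - x l)).
rewrite -[RHS](sum_antisym (P := fun k => k \notin S) (F := F)).
  apply: eq_bigr => k kS; rewrite /bd mulr_sumr; apply: eq_bigl => l.
  by rewrite !inE negb_or andbC eq_sym.
move=> k l kS lS kl; rewrite /F setUCA (addrAC w) !mulrA !ksign_setU1 //.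
have -> : (l < k)%N = ~~ (k < l)%N by move: kl; rewrite -val_eqE /=; lia.
by case: (k < l)%N => /=; rewrite ?expr0 ?expr1; ring.
Qed.

(** Truncation loses nothing here: if [w] is live and [w - x k] is dead, convexity makes every
    [w - x k - x l] dead, so [bd u] already vanishes at [w - x k]. *)
Lemma bd_cut_bd L u S w : convex_live L -> supp L u -> L w ->
  bd (cut L (bd u)) S w = 0.
Proof.
move=> cL sL Lw; rewrite -[RHS](bd_bd u S w); apply: eq_bd => k kS.
rewrite /cut; case: ifP => // /negP nL; symmetry; apply: big1 => l lS.
rewrite sL ?mulr0 //; apply/negP => Lv; apply: nL.
have -> : w - x k = w - x k - x l + x l by rewrite subrK.
by apply: (cL _ l k) => //; rewrite !subrK.
Qed.

Variable deg : G -> int.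
Hypothesis deg_x : forall w k, deg (w + x k) = deg w + 1.

Lemma deg_subx w k : deg (w - x k) = deg w - 1.
Proof. by rewrite -[in RHS](subrK (x k) w) deg_x addrK. Qed.

(* All homological degrees at once. *)
Definition exact_at (d : int) L := forall c, supp L c ->
  (forall S w, L w -> deg w = d + 1 -> bd c S w = 0) ->
  exists2 u, supp L u & forall S w, L w -> deg w = d -> c S w = bd u S w.

Section Step.
Variables (L L1 L2 : pred G) (k0 : 'I_n).
Hypothesis cL : convex_live L.
Hypothesis L1E : forall w, L1 w = L w && ~~ L (w - x k0).
Hypothesis L2E : forall w, L2 w = L w && L (w + x k0).

Lemma convex_kill : convex_live L1.
Proof.
move=> w k l; rewrite !L1E => /andP[Lw nLw] /andP[Lkl nLkl].
rewrite (cL Lw Lkl) /=; apply: contra nLkl => Lv.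
have -> : w + x k + x l - x k0 = w + x k - x k0 + x l by rewrite addrAC.
by apply: (cL (l := k0) Lv); rewrite addrAC subrK.
Qed.

Lemma convex_colon : convex_live L2.
Proof.
move=> w k l; rewrite !L2E => /andP[Lw Lw'] /andP[Lkl Lkl'].
rewrite (cL Lw Lkl) /= addrAC; apply: (cL Lw' (l := l)).
by rewrite (addrAC w) (addrAC (w + x k)).
Qed.

(* The part of c outside x_{k0} L is already a boundary; what remains is
   x_{k0} times a cycle modulo the colon ideal. *)
Lemma exact_kill d c : exact_at d L1 -> supp L c ->
  (forall S w, L w -> deg w = d + 1 -> bd c S w = 0) ->
  exists u c', [/\ supp L u, supp L2 c',
    forall S w, L2 w -> deg w = d -> bd c' S w = 0 &
    forall S w, L w -> deg w = d -> c S w = bd u S w + c' S (w - x k0)].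
Proof.
move=> ex1 sc bc.
have L1L w : L1 w -> L w by rewrite L1E => /andP[].
(* The truncation of [c] is a cycle over [L1]: if [w - x k] were live but outside [L1], then
   [w - x k - x k0] would be live and convexity would make [w - x k0] live. *)
have [|S w L1w dw|u su cu] := ex1 (cut L1 c).
- by move=> S w; rewrite /cut => /negPf->.
- rewrite -[RHS](bc S w (L1L _ L1w) dw); apply: eq_bd => k kS.
  rewrite /cut; case: ifP => // /negP nL; rewrite sc //.
  apply/negP => Lv; apply: nL; rewrite L1E Lv /=; apply/negP => Lv'.
  move: L1w; rewrite L1E => /andP[Lw /negP[]].
  have -> : w - x k0 = w - x k - x k0 + x k by rewrite addrAC subrK.
  by apply: (cL (l := k0) Lv'); rewrite addrAC !subrK.
have suL : supp L u.
  by move=> S w nLw; apply: su; apply: contra nLw; apply: L1L.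
pose c2 := fun S w => c S w - cut L (bd u) S w.
have sc2 : supp L c2 by move=> S w nLw; rewrite /c2 /cut (negPf nLw) sc // subrr.
have bc2 S w : L w -> deg w = d + 1 -> bd c2 S w = 0.
  by move=> Lw dw; rewrite bdB bc // (bd_cut_bd S cL suL Lw) subrr.
have c2L1 S w : L1 w -> deg w = d -> c2 S w = 0.
  move=> L1w dw; rewrite /c2 /cut L1L // -(cu S w L1w dw) /cut L1w subrr //.
(* In degree d, [c2] vanishes on [L1], hence is divisible by x_{k0}; the quotient is obtained by
   shifting the argument. *)
exists u, (fun S v => if L2 v then c2 S (v + x k0) else 0); split=> //.
- by move=> S w /negPf->.
- move=> S v L2v dv; have /andP[Lv Lv'] : L v && L (v + x k0) by rewrite -L2E.
  rewrite -[RHS](bc2 S (v + x k0)) ?deg_x ?dv //; apply: eq_bigr => k kS.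
  congr (_ * _); rewrite (addrAC v (x k0)); case: ifP => //; rewrite L2E => /negbT.
  rewrite negb_and => /orP nL.
  have [Lw|nLw] := boolP (L (v - x k + x k0)); last by rewrite sc2.
  case: nL => [nL|]; last by rewrite Lw.
  by rewrite c2L1 // ?L1E ?Lw ?addrK // deg_x deg_subx dv subrK.
- move=> S w Lw dw; rewrite L2E subrK Lw andbT; case: ifP => Lw'.
    by rewrite /c2 /cut Lw addrC subrK.
  rewrite addr0; apply/eqP; rewrite -subr_eq0; apply/eqP.
  by have := c2L1 S w; rewrite /c2 /cut Lw L1E Lw Lw'; apply.
Qed.

Lemma exact_step d : exact_at d L1 -> exact_at (d - 1) L2 -> exact_at d L.
Proof.
move=> ex1 ex2 c sc bc.
have [u [c' [su sc' bc' cE]]] := exact_kill ex1 sc bc.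
have [|u' su' c'E] := ex2 c' sc'; first by move=> S w L2w; rewrite subrK; apply: bc'.
exists (fun S w => u S w + u' S (w - x k0)).
  move=> S w nLw; rewrite su // su' ?addr0 // L2E subrK (negPf nLw) andbF //.
move=> S w Lw dw; rewrite cE // bdD; congr (_ + _).
have -> : bd (fun S w => u' S (w - x k0)) S w = bd u' S (w - x k0).
  by apply: eq_bigr => k _; rewrite addrAC.
have [Lw'|nLw'] := boolP (L (w - x k0)).
  by apply: c'E; rewrite ?L2E ?subrK ?Lw' // deg_subx dw.
rewrite sc' ?L2E ?(negPf nLw') //; symmetry; apply: big1 => k _.
rewrite su' ?mulr0 // L2E negb_and; apply/orP; left; apply: contra nLw' => Lv.
have -> : w - x k0 = w - x k0 - x k + x k by rewrite subrK.
by apply: (cL (l := k0) Lv); rewrite subrK subrK.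
Qed.

(* Multiplication by x_{k0} is null-homotopic on the Koszul complex. *)
Lemma exact_nzd d : (forall w, L w -> L (w + x k0)) -> exact_at d L1 ->
  exact_at d L.
Proof.
move=> nzd ex1 c sc bc.
have L2L w : L2 w = L w by rewrite L2E; case: (boolP (L w)) => //= /nzd.
have [u [c' [su sc' bc' cE]]] := exact_kill ex1 sc bc.
(* [h] is the exterior product of e_{k0} with [c']. Where [k0] is not in [S], only the term at [k0]
   of its boundary survives and gives [c'] shifted; where [k0] is in [S], the cycle equation of [c']
   at [S :\ k0] does. *)
pose h S w := if k0 \in S then ksign k0 (S :\ k0) * c' (S :\ k0) w else 0.
exists (fun S w => u S w + h S w).
  by move=> S w nLw; rewrite /h su // sc' ?L2L // mulr0 if_same addr0.
move=> S w Lw dw; rewrite cE // bdD; congr (_ + _).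
have [k0S|k0S] := boolP (k0 \in S); last first.
  rewrite /bd (bigD1 k0) //= big1 => [|k /andP[kS kk0]].
    by rewrite /h setU11 setU1K // mulrA ksign_sqr mul1r addr0.
  by rewrite /h !inE eq_sym (negPf kk0) (negPf k0S) mulr0.
have := bc' (S :\ k0) w; rewrite L2L => /(_ Lw dw).
rewrite /bd (bigD1 k0) /= ?setD11 // setD1K // => /eqP.
rewrite addr_eq0 => /eqP E.
rewrite -[LHS]mul1r -(ksign_sqr k0 (S :\ k0)) -mulrA E mulrN -mulNr mulr_sumr.
have S0 k : (k \notin S :\ k0) && (k != k0) = (k \notin S).
  by rewrite !inE; case: (eqVneq k k0) => [->|] /=; rewrite ?k0S ?andbF ?andbT.
rewrite (eq_bigl _ _ S0); apply: eq_bigr => k kS.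
have kk0 : k != k0 by apply: contraNneq kS => ->.
rewrite /h !inE k0S orbT.
have -> : (k |: S) :\ k0 = k |: (S :\ k0).
  by apply/setP => j; rewrite !inE; case: (eqVneq j k) => [->|//]; rewrite kk0.
rewrite ksign_setU1 ?inE ?(negPf kS) ?andbF //.
have -> : ksign k S = (-1) ^+ (k0 < k)%N * ksign k (S :\ k0).
  by rewrite -{1}(setD1K k0S) ksign_setU1 ?setD11.
have -> : (k < k0)%N = ~~ (k0 < k)%N by move: kk0; rewrite -val_eqE /=; lia.
by case: (k0 < k)%N => /=; rewrite ?expr0 ?expr1; ring.
Qed.

End Step.
End Koszul.

(** * Hilbert functions along the decomposition *)

(** On generating functions [delay] is multiplication by X, and [diff] is multiplication by 1 -
    X. *)
Definition delay (F : nat -> int) k : int := if k is j.+1 then F j else 0.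

Definition diff (F : nat -> int) k : int := F k - delay F k.

Lemma eq_delay F1 F2 : F1 =1 F2 -> delay F1 =1 delay F2.
Proof. by move=> e [|k] /=. Qed.

Lemma eq_iter_diff D F1 F2 : F1 =1 F2 -> iter D diff F1 =1 iter D diff F2.
Proof.
move=> e; elim: D => //= D IH k.
by rewrite /diff IH (eq_delay IH).
Qed.

Lemma iter_diffD D F1 F2 k : iter D diff (fun j => F1 j + F2 j) k =
  iter D diff F1 k + iter D diff F2 k.
Proof.
elim: D k => //= D IH k; rewrite /diff (eq_delay IH) IH.
by case: k => [|k] /=; ring.
Qed.

Lemma iter_diff_delay D F k : iter D diff (delay F) k = delay (iter D diff F) k.
Proof.
elim: D k => //= D IH k; rewrite /diff (eq_delay IH) IH.
by case: k => [|k] /=; rewrite ?subr0.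
Qed.

Lemma iter_diff_sum D F k : iter D diff F k =
  \sum_(l < D.+1 | (l <= k)%N) (-1) ^+ l * ('C(D, l))%:Z * F (k - l)%N.
Proof.
(* Extending the summand by 0 past [k] makes the range depend on D alone, so that Pascal's rule
   applies termwise. *)
pose g k l : int := if (l <= k)%N then F (k - l)%N else 0.
transitivity (\sum_(l < D.+1) (-1) ^+ l * ('C(D, l))%:Z * g k l); last first.
  rewrite [RHS]big_mkcond; apply: eq_bigr => l _; rewrite /g.
  by case: ifP; rewrite ?mulr0.
elim: D k => [|D IH] k; first by rewrite big_ord1 /g /= subn0 expr0 !mul1r.
rewrite iterS /diff IH.
have -> : delay (iter D diff F) k =
    \sum_(l < D.+1) (-1) ^+ l * ('C(D, l))%:Z * g k l.+1.
  case: k => [|k]; last by rewrite /= IH.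
  by rewrite big1 // => l _; rewrite mulr0.
rewrite [RHS]big_ord_recl /= bin0.
under [X in _ = _ + X]eq_bigr => l _.
  rewrite /bump /= add1n binS PoszD mulrDr mulrDl; over.
rewrite big_split /= [X in _ = _ + (X + _)]big_ord_recr /= bin_small //.
rewrite mulr0 mul0r addr0 big_ord_recl /= bin0 !addrA; congr (_ + _).
rewrite -sumrN; apply: eq_bigr => l _; rewrite exprS; ring.
Qed.

Section Node.
Variables (K : comNzRingType) (n : nat) (G : zmodType) (x : 'I_n -> G).
Variable deg : G -> int.
Hypothesis deg_x : forall w k, deg (w + x k) = deg w + 1.
Implicit Types (L : pred G) (p : {poly int}) (r : int) (D : nat).

Definition good L := convex_live x L /\ forall w, L w -> 0 <= deg w.

Definition layer L (d : int) (s : seq G) :=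
  uniq s /\ forall w, (w \in s) = L w && (deg w == d).

(* L has regularity at most r and Hilbert series p / (1 - X)^D. *)
Definition node r D p L := good L ->
  (forall d, r < d -> exact_at K x deg d L) /\
  exists s : nat -> seq G, (forall d : nat, layer L d (s d)) /\
    forall k, iter D diff (fun d => (size (s d))%:Z) k = p`_k.

Lemma node_weaken r r' D p L : r <= r' -> node r D p L -> node r' D p L.
Proof.
move=> rr' nL /nL[ex hs]; split=> // d /(le_lt_trans rr'); exact: ex.
Qed.

(** Used to give the two branches of a splitting the same denominator. *)
Lemma node_lift r D p L : node r D p L -> node r D.+1 ((1 - 'X) * p) L.
Proof.
move=> nL /nL[ex [s [ls hs]]]; split=> //; exists s; split=> // k.
rewrite iterS /diff (eq_delay hs) hs mulrBl mul1r coefB coefXM.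
by case: k.
Qed.

Lemma node_pred1 L : L =1 pred1 0 -> deg 0 = 0 -> node 0 0 1 L.
Proof.
move=> L0 d0 _; split=> [d dpos c _ _|].
  exists (fun _ _ => 0) => // S w; rewrite L0 => /eqP -> /eqP.
  by rewrite d0 lt_eqF.
exists (fun d => if d is 0%N then [:: 0] else [::]).
split=> [d|[|k]]; [split=> [|w]; first by case: d | by rewrite coef1 ..].
by rewrite L0; case: d => [|d]; rewrite !inE; case: eqP => //= ->; rewrite d0.
Qed.

Section Step.
Variables (L L1 L2 : pred G) (k0 : 'I_n) (r : int) (D : nat).
Hypothesis L1E : forall w, L1 w = L w && ~~ L (w - x k0).
Hypothesis L2E : forall w, L2 w = L w && L (w + x k0).

(** [node] assumes goodness rather than carrying it, so goodness is checked once for the whole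
    monoid and descends to every branch. *)
Lemma good_kill : good L -> good L1.
Proof.
case=> cL pL; split; first exact: convex_kill L1E.
by move=> w; rewrite L1E => /andP[/pL].
Qed.

Lemma good_colon : good L -> good L2.
Proof.
case=> cL pL; split; first exact: convex_colon L2E.
by move=> w; rewrite L2E => /andP[/pL].
Qed.

(** [L] is the disjoint union of [L1] and the translate of [L2] by [x k0], according to whether
    [w - x k0] is live. *)
Lemma layer_step d s1 s2 : layer L1 d s1 -> layer L2 (d - 1) s2 ->
  layer L d (s1 ++ [seq v + x k0 | v <- s2]).
Proof.
move=> [us1 ms1] [us2 ms2].
have memS w : (w \in [seq v + x k0 | v <- s2]) =
    [&& L w, L (w - x k0) & deg w == d].
  apply/mapP/and3P => [[v]|[Lw Lv /eqP dw]].
    rewrite ms2 L2E => /andP[/andP[Lv Lw] /eqP dv] ->.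
    by rewrite addrK deg_x dv Lw Lv subrK.
  exists (w - x k0); last by rewrite subrK.
  by rewrite ms2 L2E subrK Lw Lv (deg_subx deg_x) dw eqxx.
split=> [|w]; last first.
  rewrite mem_cat ms1 L1E memS.
  by case: (L w) (L (w - x k0)) => [] [] //=; rewrite ?orbF.
rewrite cat_uniq us1 (map_inj_uniq (addIr _)) us2 andbT.
apply/hasPn => w; rewrite memS ms1 L1E => /and3P[_ -> _].
by rewrite andbF.
Qed.

Lemma layer_nil L' d : good L' -> d < 0 -> layer L' d [::].
Proof.
move=> [_ pL] d0; split=> // w; rewrite in_nil; symmetry; apply/negP.
by case/andP => /pL w0 /eqP dw; move: w0; rewrite dw leNgt d0.
Qed.

Lemma node_step p1 p2 :
  node r D p1 L1 -> node (r - 1) D p2 L2 -> node r D (p1 + 'X * p2) L.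
Proof.
move=> n1 n2 gL.
have [ex1 [s1 [ls1 hs1]]] := n1 (good_kill gL).
have [ex2 [s2 [ls2 hs2]]] := n2 (good_colon gL).
split.
  move=> d rd; apply: (exact_step deg_x gL.1 L1E L2E); first exact: ex1.
  by apply: ex2; rewrite ltrD2r.
exists (fun d => s1 d ++ [seq v + x k0 | v <- if d is j.+1 then s2 j else [::]]).
split=> [[|d]|k].
(* Degree 0 receives nothing from [L2], whose layer in degree -1 is empty. *)
- by apply: layer_step => //; apply: layer_nil => //; apply: good_colon.
- by apply: layer_step => //; rewrite -addn1 PoszD addrK.
rewrite (@eq_iter_diff D _ (fun d => (size (s1 d))%:Z
  + delay (fun d => (size (s2 d))%:Z) d)); last first.
  by case=> [|d]; rewrite size_cat size_map PoszD.
rewrite iter_diffD hs1 iter_diff_delay (eq_delay hs2) coefD coefXM.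
by case: k.
Qed.

Lemma node_nzd p : (forall w, L w -> L (w + x k0)) ->
  node r D p L1 -> node r D.+1 p L.
Proof.
move=> nzd n1 gL; have [ex1 [s1 [ls1 hs1]]] := n1 (good_kill gL).
split; first by move=> d rd; apply: (exact_nzd deg_x gL.1 L1E L2E) => //; exact: ex1.
have L2L w : L2 w = L w by rewrite L2E; case: (boolP (L w)) => //= /nzd.
have layer2 d s : layer L d s -> layer L2 d s.
  by case=> us ms; split=> // w; rewrite ms L2L.
(* As [L2] equals [L], each layer of [L] consists of a layer of [L1] and the translate of the
   previous layer of [L] itself. *)
pose s := fix s d := s1 d ++ [seq v + x k0 | v <- if d is j.+1 then s j else [::]].
have ls d : layer L (Posz d) (s d).
  elim: d => [|d IH]; apply: layer_step => //.
    by apply: layer_nil => //; apply: good_colon.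
  by apply: layer2; rewrite -addn1 PoszD addrK.
exists s; split=> // k; rewrite iterSr -hs1; apply: eq_iter_diff.
case=> [|d]; rewrite /diff /= size_cat ?size_map PoszD /= ?subr0 ?addr0 //.
by rewrite addrK.
Qed.
End Step.
End Node.

(** * The edge monoid of G_t *)

Section Graph.
Variable t : nat.

(* Coordinates e2, e3, f1, f2, f3, then the exponent al of x1 and the exponents
   y of the y_i in the Segre ring, where a_i = x1 y_i and b_i = x2 y_i (so the
   exponent of x2 is |y| - al).  The relation e1 e3 f2 b_i b_j = e2 f1 f3 a_i a_j
   is solved for e1. *)
Definition lat : Type :=
  (int * int * int * int * int * int * {ffun 'I_t -> int})%type.
HB.instance Definition _ := GRing.Zmodule.on lat.

Definition vec (e2 e3 f1 f2 f3 al : int) (y : {ffun 'I_t -> int}) : lat :=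
  (e2, e3, f1, f2, f3, al, y).

Lemma vecD e2 e3 f1 f2 f3 al y e2' e3' f1' f2' f3' al' y' :
  vec e2 e3 f1 f2 f3 al y + vec e2' e3' f1' f2' f3' al' y' =
  vec (e2 + e2') (e3 + e3') (f1 + f1') (f2 + f2') (f3 + f3') (al + al') (y + y').
Proof. by []. Qed.

Lemma vecB e2 e3 f1 f2 f3 al y e2' e3' f1' f2' f3' al' y' :
  vec e2 e3 f1 f2 f3 al y - vec e2' e3' f1' f2' f3' al' y' =
  vec (e2 - e2') (e3 - e3') (f1 - f1') (f2 - f2') (f3 - f3') (al - al') (y - y').
Proof. by []. Qed.

Definition ydelta (i : nat) : {ffun 'I_t -> int} :=
  [ffun j : 'I_t => if (j : nat) == i then 1 else 0].

Definition ysum (y : {ffun 'I_t -> int}) : int := \sum_j y j.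

(** The vector of e1 is that of the fraction e2 f1 f3 a_i a_j / (e3 f2 b_i b_j): the y exponents
    cancel and x1 keeps exponent 2. *)
Definition edge_vec (k : nat) : lat :=
  if (k < t)%N then vec 0 0 0 0 0 1 (ydelta k)
  else if k == t then vec 0 0 1 0 0 0 0
  else if k == (t + 1)%N then vec 0 0 0 1 0 0 0
  else if k == (t + 2)%N then vec 0 0 0 0 1 0 0
  else if k == (t + 3)%N then vec 1 (-1) 1 (-1) 1 2 0
  else if k == (t + 4)%N then vec 1 0 0 0 0 0 0
  else if k == (t + 5)%N then vec 0 1 0 0 0 0 0
  else vec 0 0 0 0 0 0 (ydelta (k - (t + 6))).

Definition gen (k : 'I_(Gt_nE t)) : lat := edge_vec k.

(** The total degree in the edges; [al] is left out because each a_i and each b_i is already counted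
    once in |y|. *)
Definition wt (w : lat) : int :=
  let: (e2, e3, f1, f2, f3, _, y) := w in e2 + e3 + f1 + f2 + f3 + ysum y.

Lemma ysumD y y' : ysum (y + y') = ysum y + ysum y'.
Proof. by rewrite /ysum -big_split; apply: eq_bigr => j _; rewrite ffunE. Qed.

Lemma ysum0 : ysum 0 = 0.
Proof. by apply: big1 => j _; rewrite ffunE. Qed.

Lemma ysumN y : ysum (- y) = - ysum y.
Proof. by rewrite /ysum -sumrN; apply: eq_bigr => j _; rewrite ffunE. Qed.

Lemma ysum_delta i : (i < t)%N -> ysum (ydelta i) = 1.
Proof.
move=> it; rewrite /ysum (bigD1 (Ordinal it)) //= ffunE eqxx big1 ?addr0 //.
by move=> j; rewrite -val_eqE ffunE /= => /negPf->.
Qed.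

Variant edge_spec : lat -> Type :=
| EdgeA i of (i < t)%N : edge_spec (vec 0 0 0 0 0 1 (ydelta i))
| EdgeB i of (i < t)%N : edge_spec (vec 0 0 0 0 0 0 (ydelta i))
| EdgeE1 : edge_spec (vec 1 (-1) 1 (-1) 1 2 0)
| EdgeE2 : edge_spec (vec 1 0 0 0 0 0 0)
| EdgeE3 : edge_spec (vec 0 1 0 0 0 0 0)
| EdgeF1 : edge_spec (vec 0 0 1 0 0 0 0)
| EdgeF2 : edge_spec (vec 0 0 0 1 0 0 0)
| EdgeF3 : edge_spec (vec 0 0 0 0 1 0 0).

Lemma edge_vecP (k : nat) : (k < Gt_nE t)%N -> edge_spec (edge_vec k).
Proof.
rewrite /Gt_nE /edge_vec => kn; case: ifP => [|kt]; first exact: EdgeA.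
do 6 (case: eqP => [_|?]; first by constructor).
by apply: EdgeB; lia.
Qed.

Lemma wt_gen w k : wt (w + gen k) = wt w + 1.
Proof.
rewrite /gen; case: (edge_vecP (ltn_ord k)); case: w => [[[[[[e2 e3] f1] f2] f3] al] y] >;
  try move=> it; rewrite vecD /= ysumD ?ysum0 ?ysum_delta //; ring.
Qed.

(** The bound [s] counts the vertices y_i still present; the inductions below remove them one at a
    time. *)
Definition ypos (s : nat) (y : {ffun 'I_t -> int}) :=
  [forall j : 'I_t, (0 <= y j) && ((s <= j)%N ==> (y j == 0))].

Lemma ypos_sub s (i : 'I_t) y : (i < s)%N ->
  ypos s (y - ydelta i) = ypos s y && (1 <= y i).
Proof.
move=> si; apply/forallP/andP => [h|[/forallP h yi] j].
  split; last by have := h i; rewrite !ffunE eqxx; move: (y i : int) => z; lia.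
  apply/forallP => j; have := h j; rewrite !ffunE; move: (y j : int) => z.
  by have [->|] := eqVneq (j : nat) i; lia.
have := h j; rewrite !ffunE; have [/val_inj ->|_] := eqVneq (j : nat) i.
  by move: (y i : int) yi => z; lia.
by move: (y j : int) => z; lia.
Qed.

Lemma ypos_add s (i : 'I_t) y : (i < s)%N -> ypos s y -> ypos s (y + ydelta i).
Proof.
move=> si /forallP h; apply/forallP => j; have := h j; rewrite !ffunE.
by move: (y j : int) => z; have [->|] := eqVneq (j : nat) i; lia.
Qed.

Lemma yposS (i : 'I_t) y : ypos i y = ypos i.+1 y && (y i == 0).
Proof.
apply/forallP/andP => [h|[/forallP h /eqP yi] j].
  split; first apply/forallP => j; first have := h j.
    by move: (y j : int) => z; lia.
  by have := h i; rewrite leqnn; move: (y i : int) => z; lia.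
have := h j; have [/val_inj ->|] := eqVneq (j : nat) i; first by rewrite yi; lia.
by move: (y j : int) => z; lia.
Qed.

Lemma ypos_ysum s (i : 'I_t) y : ypos s y -> 0 <= y i <= ysum y.
Proof.
move=> /forallP h; have h0 j : 0 <= y j by have /andP[] := h j.
rewrite h0 /ysum (bigD1 i) //= lerDl sumr_ge0 //.
Qed.

Definition live (s : nat) (p : int -> int -> int -> int -> int -> int -> bool)
    (w : lat) : bool :=
  let: (e2, e3, f1, f2, f3, al, y) := w in
  [&& p e2 e3 f1 f2 f3 al, ypos s y & 0 <= al <= ysum y].

End Graph.

(** * The decomposition tree *)

Section Tree.
Variables (K : comNzRingType) (t : nat).

Lemma lat_elim (P : lat t -> Prop) :
  (forall e2 e3 f1 f2 f3 al y, P (vec e2 e3 f1 f2 f3 al y)) -> forall w, P w.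
Proof. by move=> H [[[[[[]]]]]]. Qed.

Lemma live_vec s p e2 e3 f1 f2 f3 al (y : {ffun 'I_t -> int}) :
  live s p (vec e2 e3 f1 f2 f3 al y) =
  [&& p e2 e3 f1 f2 f3 al, ypos s y & 0 <= al <= ysum y].
Proof. by []. Qed.

Lemma edge_a (i : 'I_t) :
  {k : 'I_(Gt_nE t) | gen k = vec 0 0 0 0 0 1 (ydelta t i)}.
Proof.
have ik : (i < Gt_nE t)%N by rewrite /Gt_nE; have := ltn_ord i; lia.
by exists (Ordinal ik); rewrite /gen /edge_vec /= ltn_ord.
Qed.

Lemma edge_b (i : 'I_t) :
  {k : 'I_(Gt_nE t) | gen k = vec 0 0 0 0 0 0 (ydelta t i)}.
Proof.
have ik : (t + 6 + i < Gt_nE t)%N by rewrite /Gt_nE; have := ltn_ord i; lia.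
exists (Ordinal ik); rewrite /gen /edge_vec /= addKn.
by do 7 (case: ifP => [|_]; first lia).
Qed.

Lemma edge_ef (j : 'I_6) : {k : 'I_(Gt_nE t) | gen k = nth 0
  [:: vec 0 0 1 0 0 0 0; vec 0 0 0 1 0 0 0; vec 0 0 0 0 1 0 0;
      vec 1 (-1) 1 (-1) 1 2 0; vec 1 0 0 0 0 0 0; vec 0 1 0 0 0 0 0] j}.
Proof.
have jk : (t + j < Gt_nE t)%N by rewrite /Gt_nE; have := ltn_ord j; lia.
exists (Ordinal jk); rewrite /gen /edge_vec /=.
case: ifP => [|_]; first lia.
rewrite -[X in _ == X]addn0 !eqn_add2l.
by case: j jk => [[|[|[|[|[|[|]]]]]]].
Qed.

Notation nd := (node K (@gen t) (@wt t)).

Definition zero5 (e2 e3 f1 f2 f3 : int) :=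
  [&& e2 == 0, e3 == 0, f1 == 0, f2 == 0 & f3 == 0].

Lemma live0 (p : int -> int -> int -> int -> int -> int -> bool) : p 0 0 0 0 0 0 ->
  (forall e2 e3 f1 f2 f3 al, p e2 e3 f1 f2 f3 al -> zero5 e2 e3 f1 f2 f3) ->
  live 0 p =1 pred1 (0 : lat t).
Proof.
move=> p0 pz; elim/lat_elim => e2 e3 f1 f2 f3 al y; rewrite live_vec /=.
apply/and3P/eqP => [[pe /forallP y0 al0]|].
  have {}y0 : y = 0.
    apply/ffunP => j; rewrite ffunE; have := y0 j => /andP[_].
    by rewrite leq0n => /eqP.
  move: (pz _ _ _ _ _ _ pe) al0; rewrite y0 ysum0.
  case/and5P => /eqP-> /eqP-> /eqP-> /eqP-> /eqP-> h.
  by have -> : al = 0 by lia.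
case=> -> -> -> -> -> -> ->; rewrite p0 ysum0; split=> //.
by apply/forallP => j; rewrite ffunE eqxx implybT.
Qed.

(** With [al = 0] no a_i survives: this is the polynomial ring in the b_i. *)
Definition p_face e2 e3 f1 f2 f3 (al : int) := zero5 e2 e3 f1 f2 f3 && (al == 0).

Definition p_cap (cap : bool) e2 e3 f1 f2 f3 (al : int) :=
  zero5 e2 e3 f1 f2 f3 && (cap ==> (al <= 1)).

Lemma node_face s : (s <= t)%N -> nd 0 s 1 (live s p_face).
Proof.
elim: s => [|s IH] st.
  by apply: node_pred1; [apply: live0 => // > /andP[] | rewrite /= ysum0].
pose i := Ordinal st; have [k kE] := edge_b i.
apply: (node_nzd (@wt_gen t) (k0 := k) (L1 := live s p_face) _ (fun w => erefl)).
- elim/lat_elim => e2 e3 f1 f2 f3 al y.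
  rewrite kE vecB !live_vec !subr0 ypos_sub // ysumD ysumN ysum_delta //.
  rewrite (@yposS _ i) /p_face /zero5.
  have [|//] := boolP (ypos i.+1 y); last by rewrite !andbF.
  move=> /(ypos_ysum i); move: (y i : int) => z; lia.
- elim/lat_elim => e2 e3 f1 f2 f3 al y.
  rewrite kE vecD !live_vec !addr0 ysumD ysum_delta //.
  by case/and3P => -> yp h; rewrite ypos_add //=; lia.
- by apply: IH; lia.
Qed.

(** The quotient by the a edge at index [s]: subtracting that edge leaves the live set exactly when
    its y exponent or [al] is 0. Quantifying over [i] avoids carrying a proof of [s < t]. *)
Definition mid s cap (w : lat t) : bool :=
  live s.+1 (p_cap cap) w &&
  let: (_, _, _, _, _, al, y) := w in
  [forall i : 'I_t, (i == s :> nat) ==> ((y i == 0) || (al == 0))].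

Lemma mid_vec (i : 'I_t) cap e2 e3 f1 f2 f3 al (y : {ffun 'I_t -> int}) :
  mid i cap (vec e2 e3 f1 f2 f3 al y) =
  live i.+1 (p_cap cap) (vec e2 e3 f1 f2 f3 al y) && ((y i == 0) || (al == 0)).
Proof.
rewrite /mid; congr (_ && _); apply/forallP/idP => [/(_ i)|h j]; first by rewrite eqxx.
by apply/implyP => /eqP/val_inj ->.
Qed.

(** Splitting along b_i: killing b_i removes y_i altogether, while multiplication by b_i makes the
    exponent of y_i positive and so forces [al = 0], the polynomial ring in the b edges. *)
Lemma node_mid (i : 'I_t) cap D p :
  nd 1 D p (live i (p_cap cap)) -> nd 0 D 1 (live i.+1 p_face) ->
  nd 1 D (p + 'X) (mid i cap).
Proof.
move=> n1 n2; rewrite -['X]mulr1; have [k kE] := edge_b i.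
apply: (node_step (@wt_gen t) (k0 := k) _ _ n1 n2); elim/lat_elim => e2 e3 f1 f2 f3 al y.
  rewrite kE vecB !mid_vec !live_vec !subr0 ypos_sub // ysumD ysumN ysum_delta //.
  rewrite (@yposS _ i) /p_cap /zero5 !ffunE eqxx.
  have [|] := boolP (ypos i.+1 y); last by rewrite !andbF.
  by move=> /(ypos_ysum i); move: (y i : int) => z; lia.
rewrite kE vecD !mid_vec !live_vec !addr0 ysumD ysum_delta //.
rewrite /p_cap /p_face /zero5 !ffunE eqxx.
have [yp|] := boolP (ypos i.+1 y); last by rewrite !andbF.
rewrite ypos_add //; move: (ypos_ysum i yp); move: (y i : int) => z; lia.
Qed.

Lemma node_full s : (s <= t)%N ->
  nd 1 s.+1 (1 + (s%:Z - 1) *: 'X) (live s (p_cap false)).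
Proof.
elim: s => [|s IH] st.
  (* With no y_i left the ring is K, whose series 1 is written (1 - X) / (1 - X) to fit the exponent
     [s.+1]. *)
  have -> : 1 + (0%:Z - 1) *: 'X = (1 - 'X) * 1 :> {poly int} by rewrite mulr1 scaleN1r.
  apply: node_lift; apply: (@node_weaken _ _ _ _ _ 0) => //.
  by apply: node_pred1; [apply: live0 => // > /andP[] | rewrite /= ysum0].
pose i := Ordinal st; have [k kE] := edge_a i.
apply: (node_nzd (@wt_gen t) (k0 := k) (L1 := mid i false) _ (fun w => erefl)).
- elim/lat_elim => e2 e3 f1 f2 f3 al y.
  rewrite kE vecB mid_vec !live_vec !subr0 ypos_sub // ysumD ysumN ysum_delta //.
  rewrite /p_cap /zero5 -[(i : nat)]/s.
  have [|] := boolP (ypos s.+1 y); last by rewrite !andbF.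
  by move=> /(ypos_ysum i); move: (y i : int) => z; lia.
- elim/lat_elim => e2 e3 f1 f2 f3 al y.
  rewrite kE vecD !live_vec !addr0 ysumD ysum_delta //.
  by case/and3P => pe yp h; rewrite ypos_add // andTb; move: pe h; rewrite /p_cap /zero5; lia.
have -> : 1 + (s.+1%:Z - 1) *: 'X = 1 + (s%:Z - 1) *: 'X + 'X :> {poly int}.
  by rewrite -addrA -[X in _ + (_ + X)]scale1r -scalerDl -addn1 PoszD; congr (_ + _ *: _); ring.
by apply: node_mid; [apply: IH; lia | apply: node_face].
Qed.

Lemma node_capped s : (s <= t)%N ->
  nd 1 s (2%:R - (1 - 'X) ^+ s) (live s (p_cap true)).
Proof.
elim: s => [|s IH] st.
  rewrite expr0 addrK; apply: (@node_weaken _ _ _ _ _ 0) => //.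
  by apply: node_pred1; [apply: live0 => // > /andP[] | rewrite /= ysum0].
pose i := Ordinal st; have [k kE] := edge_a i.
(* The factor 1 - X raises the denominator of the smaller capped ring. The two terms X come from the
   colons by b_i and by a_i, both polynomial rings in the b edges: under the cap, a_i is a
   zerodivisor. *)
have -> : 2%:R - (1 - 'X) ^+ s.+1 =
    (1 - 'X) * (2%:R - (1 - 'X) ^+ s) + 'X + 'X * 1 :> {poly int}.
  by rewrite exprS; ring.
apply: (node_step (@wt_gen t) (k0 := k) (L1 := mid i true) (L2 := live s.+1 p_face)).
- elim/lat_elim => e2 e3 f1 f2 f3 al y.
  rewrite kE vecB mid_vec !live_vec !subr0 ypos_sub // ysumD ysumN ysum_delta //.
  rewrite /p_cap /zero5 -[(i : nat)]/s.
  have [|] := boolP (ypos s.+1 y); last by rewrite !andbF.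
  by move=> /(ypos_ysum i); move: (y i : int) => z; lia.
- elim/lat_elim => e2 e3 f1 f2 f3 al y.
  rewrite kE vecD !live_vec !addr0 ysumD ysum_delta //.
  have [yp|] := boolP (ypos s.+1 y); last by rewrite !andbF.
  by rewrite ypos_add // /p_face /p_cap /zero5; lia.
- by apply: node_mid; [apply: node_lift; apply: IH; lia | apply: node_face].
- exact: node_face.
Qed.

End Tree.

(** * Splitting along the triangle edges and reinserting e1 *)

Section Root.
Variables (K : comNzRingType) (t : nat).
Notation nd := (node K (@gen t) (@wt t)).
Implicit Types p : int -> int -> int -> int -> int -> int -> bool.

Section TriangleStep.
Variables (k : 'I_(Gt_nE t)) (d2 d3 g1 g2 g3 : int).
Hypothesis kE : gen k = vec d2 d3 g1 g2 g3 0 0.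

Lemma live_kill p1 p :
  (forall e2 e3 f1 f2 f3 al, p1 e2 e3 f1 f2 f3 al =
     p e2 e3 f1 f2 f3 al && ~~ p (e2 - d2) (e3 - d3) (f1 - g1) (f2 - g2) (f3 - g3) al) ->
  forall w, live t p1 w = live t p w && ~~ live t p (w - gen k).
Proof.
move=> h; elim/lat_elim => e2 e3 f1 f2 f3 al y; rewrite kE vecB !live_vec !subr0 h.
by case: (ypos t y && _); rewrite ?andbT ?andbF.
Qed.

Lemma triangle_step r D q1 q2 p p1 p2 :
  nd r D q1 (live t p1) -> nd (r - 1) D q2 (live t p2) ->
  (forall e2 e3 f1 f2 f3 al, p1 e2 e3 f1 f2 f3 al =
     p e2 e3 f1 f2 f3 al && ~~ p (e2 - d2) (e3 - d3) (f1 - g1) (f2 - g2) (f3 - g3) al) ->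
  (forall e2 e3 f1 f2 f3 al, p2 e2 e3 f1 f2 f3 al =
     p e2 e3 f1 f2 f3 al && p (e2 + d2) (e3 + d3) (f1 + g1) (f2 + g2) (f3 + g3) al) ->
  nd r D (q1 + 'X * q2) (live t p).
Proof.
move=> n1 n2 h1 h2.
apply: (node_step (@wt_gen t) (k0 := k) (live_kill h1) _ n1 n2).
elim/lat_elim => e2 e3 f1 f2 f3 al y; rewrite kE vecD !live_vec !addr0 h2.
by case: (ypos t y && _); rewrite ?andbT ?andbF.
Qed.

Lemma triangle_nzd r D q p p1 :
  nd r D q (live t p1) ->
  (forall e2 e3 f1 f2 f3 al, p1 e2 e3 f1 f2 f3 al =
     p e2 e3 f1 f2 f3 al && ~~ p (e2 - d2) (e3 - d3) (f1 - g1) (f2 - g2) (f3 - g3) al) ->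
  (forall e2 e3 f1 f2 f3 al, p e2 e3 f1 f2 f3 al ->
     p (e2 + d2) (e3 + d3) (f1 + g1) (f2 + g2) (f3 + g3) al) ->
  nd r D.+1 q (live t p).
Proof.
move=> n1 h1 h2.
apply: (node_nzd (@wt_gen t) (k0 := k) (live_kill h1) (fun w => erefl) _ n1).
elim/lat_elim => e2 e3 f1 f2 f3 al y; rewrite kE vecD !live_vec !addr0.
by case/andP => /h2 ->.
Qed.

End TriangleStep.

Definition p_nneg (e2 e3 f1 f2 f3 al : int) :=
  [&& 0 <= e2, 0 <= e3, 0 <= f1, 0 <= f2 & 0 <= f3].

(** Exponents surviving modulo e1, where the quintic relations make every e2 f1 f3 a_i a_j vanish;
    [2 <= al] encodes divisibility by some a_i a_j. *)
Definition p_init (e2 e3 f1 f2 f3 al : int) :=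
  p_nneg e2 e3 f1 f2 f3 al && ~~ [&& 1 <= e2, 1 <= f1, 1 <= f3 & 2 <= al].

Definition qfull : {poly int} := 1 + (t%:Z - 1) *: 'X.

Definition qcap : {poly int} := 2%:R - (1 - 'X) ^+ t.

Definition hpoly : {poly int} :=
  qfull + 'X * (qfull + 'X * (qfull + 'X * qcap)).

Lemma node_init : nd 4 (t + 5) hpoly (live t p_init).
Proof.
have [kf1 f1E] := edge_ef t (inord 0).
have [kf2 f2E] := edge_ef t (inord 1).
have [kf3 f3E] := edge_ef t (inord 2).
have [ke2 e2E] := edge_ef t (inord 4).
have [ke3 e3E] := edge_ef t (inord 5).
rewrite inordK //= in f1E; rewrite inordK //= in f2E; rewrite inordK //= in f3E.
rewrite inordK //= in e2E; rewrite inordK //= in e3E.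
have A0 := node_full K (leqnn t); have C0 := node_capped K (leqnn t).
(* The tree is assembled from its leaves. Splitting along f3, then f1, then e2 takes the Segre ring
   as the killed part and the previous stage as the colon, giving regularity 2, 3, 4. Variables
   absent from the remaining relations, such as e3 and f2, are adjoined as nonzerodivisors. *)
have C3 : nd 1 t.+1 qcap (live t (fun e2 e3 f1 f2 f3 al : int =>
    [&& e2 == 0, e3 == 0, f1 == 0, f2 == 0, 0 <= f3 & al <= 1])).
  by apply: (triangle_nzd f3E C0) => *; rewrite /p_cap /zero5; lia.
have N3 : nd 2 t.+1 (qfull + 'X * qcap) (live t (fun e2 e3 f1 f2 f3 al : int =>
    [&& e2 == 0, e3 == 0, f1 == 0, f2 == 0, 0 <= f3 & ~~ [&& 1 <= f3 & 2 <= al]])).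
  by apply: (triangle_step (r := 2) f3E (node_weaken (isT : 1 <= 2 :> int) A0) C3) => // *; rewrite /p_cap /zero5; lia.
have A3 : nd 1 t.+2 qfull (live t (fun e2 e3 f1 f2 f3 al : int =>
    [&& e2 == 0, e3 == 0, f1 == 0, f2 == 0 & 0 <= f3])).
  by apply: (triangle_nzd f3E A0) => *; rewrite /p_cap /zero5; lia.
have N31 : nd 2 t.+2 (qfull + 'X * qcap) (live t (fun e2 e3 f1 f2 f3 al : int =>
    [&& e2 == 0, e3 == 0, 0 <= f1, f2 == 0, 0 <= f3 & ~~ [&& 1 <= f3 & 2 <= al]])).
  by apply: (triangle_nzd f1E N3) => *; lia.
have N1 : nd 3 t.+2 (qfull + 'X * (qfull + 'X * qcap)) (live t (fun e2 e3 f1 f2 f3 al : int =>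
    [&& e2 == 0, e3 == 0, 0 <= f1, f2 == 0, 0 <= f3 &
        ~~ [&& 1 <= f1, 1 <= f3 & 2 <= al]])).
  by apply: (triangle_step (r := 3) f1E (node_weaken (isT : 1 <= 3 :> int) A3) N31) => // *; lia.
have A31 : nd 1 t.+3 qfull (live t (fun e2 e3 f1 f2 f3 al : int =>
    [&& e2 == 0, e3 == 0, 0 <= f1, f2 == 0 & 0 <= f3])).
  by apply: (triangle_nzd f1E A3) => *; lia.
have N12 : nd 3 t.+3 (qfull + 'X * (qfull + 'X * qcap)) (live t (fun e2 e3 f1 f2 f3 al : int =>
    [&& 0 <= e2, e3 == 0, 0 <= f1, f2 == 0, 0 <= f3 &
        ~~ [&& 1 <= f1, 1 <= f3 & 2 <= al]])).
  by apply: (triangle_nzd e2E N1) => *; lia.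
have N2 : nd 4 t.+3 hpoly (live t (fun e2 e3 f1 f2 f3 al : int =>
    [&& 0 <= e2, e3 == 0, 0 <= f1, f2 == 0, 0 <= f3 &
        ~~ [&& 1 <= e2, 1 <= f1, 1 <= f3 & 2 <= al]])).
  by apply: (triangle_step (r := 4) e2E (node_weaken (isT : 1 <= 4 :> int) A31) N12) => // *; lia.
have N2e : nd 4 t.+4 hpoly (live t (fun e2 e3 f1 f2 f3 al : int =>
    [&& 0 <= e2, 0 <= e3, 0 <= f1, f2 == 0, 0 <= f3 &
        ~~ [&& 1 <= e2, 1 <= f1, 1 <= f3 & 2 <= al]])).
  by apply: (triangle_nzd e3E N2) => *; lia.
have -> : (t + 5 = t.+4.+1)%N by lia.
by apply: (triangle_nzd f2E N2e) => e2 e3 f1 f2 f3 al; rewrite /p_init /p_nneg; lia.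
Qed.

Definition e1mul (j : nat) : lat t := vec j%:Z (- j%:Z) j%:Z (- j%:Z) j%:Z (2 * j%:Z) 0.

(** The multiplicity [j] of e1 is at most the first coordinate of [w], so a bounded search decides
    membership. *)
Definition in_monoid (w : lat t) : bool :=
  let: (e2, _, _, _, _, _, _) := w in
  [exists j : 'I_(`|e2|%N.+1), live t p_nneg (w - e1mul j)].

Lemma monoidP w : reflect (exists j, live t p_nneg (w - e1mul j)) (in_monoid w).
Proof.
case: w => [[[[[[e2 e3] f1] f2] f3] al] y].
rewrite -[(_, y)]/(vec e2 e3 f1 f2 f3 al y); apply: (iffP existsP) => -[j hj].
  by exists j.
have je : (j < `|e2|.+1)%N.
  by move: hj; rewrite /e1mul vecB live_vec /p_nneg; case/and3P => /and5P[]; lia.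
by exists (Ordinal je).
Qed.

Lemma live_nneg_x w k : live t p_nneg w ->
  (gen k = vec 1 (-1) 1 (-1) 1 2 0 :> lat t) \/ live t p_nneg (w + gen k).
Proof.
rewrite /gen; case: (edge_vecP (ltn_ord k)) => [i it|i it||||||]; try (by left);
  right; elim/lat_elim: w H => e2 e3 f1 f2 f3 al y; rewrite vecD !live_vec ?addr0 /p_nneg;
  case/and3P => pe yp ya;
  rewrite ?(ypos_add (i := Ordinal it)) //= ?yp ?ysumD ?ysum_delta //; lia.
Qed.

Lemma e1mul0 : e1mul 0 = 0. Proof. by []. Qed.

Lemma e1mulS j : e1mul j.+1 = e1mul j + vec 1 (-1) 1 (-1) 1 2 0.
Proof. rewrite /e1mul vecD addr0; congr vec; lia. Qed.

Lemma monoid_x w k : in_monoid w -> in_monoid (w + gen k).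
Proof.
case/monoidP => j hj; apply/monoidP; case: (live_nneg_x k hj) => [kE|h].
  by exists j.+1; rewrite kE e1mulS opprD addrACA subrr addr0.
by exists j; rewrite addrAC.
Qed.

Lemma wt_monoid w : in_monoid w -> 0 <= wt w.
Proof.
case/monoidP => j; elim/lat_elim: w => e2 e3 f1 f2 f3 al y.
rewrite /e1mul vecB live_vec subr0 /p_nneg /=; lia.
Qed.

Lemma monoid_good : good (@gen t) (@wt t) in_monoid.
Proof.
split; last exact: wt_monoid.
by move=> w k l + _; apply: monoid_x.
Qed.

(** The monoid is closed under adding e1, so e1 is a nonzerodivisor. If [w - e1] is not in the
    monoid then [w] lies in the nonnegative cone, and there subtracting e1 fails exactly when one of
    e2, f1, f3 is 0 or [al] is below 2, which is [p_init]. *)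
Lemma node_monoid : nd 4 (t + 6) hpoly in_monoid.
Proof.
have [k kE] := edge_ef t (inord 3); rewrite inordK //= in kE.
rewrite addnS; apply: (node_nzd (@wt_gen t) (k0 := k) (L1 := live t p_init) _ (fun w => erefl)).
- move=> w; rewrite kE; apply/idP/andP => [h|[/monoidP[[|j] hj] /monoidP nw]].
  + split.
      apply/monoidP; exists 0%N; rewrite e1mul0 subr0.
      by elim/lat_elim: w h => > /andP[/andP[pw _] yw]; rewrite live_vec pw.
    apply/monoidP => -[j].
    rewrite -addrA -opprD (addrC (vec _ _ _ _ _ _ _)) -e1mulS.
    elim/lat_elim: w h => e2 e3 f1 f2 f3 al y.
    rewrite /e1mul vecB !live_vec !subr0 /p_init /p_nneg; lia.
  + rewrite e1mul0 subr0 in hj; elim/lat_elim: w hj nw => e2 e3 f1 f2 f3 al y hj nw.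
    apply: contraT => h; case: nw; exists 0%N; move: hj h.
    by rewrite e1mul0 subr0 vecB !live_vec !subr0 /p_init /p_nneg; lia.
  + by case: nw; exists j; rewrite -addrA -opprD (addrC (vec _ _ _ _ _ _ _)) -e1mulS.
- by move=> w; apply: monoid_x.
- exact: node_init.
Qed.
End Root.

(** * Degree and value at 1 of the h-polynomial *)

(** The power (1 - X)^t dominates: [qcap] has degree t, and each of the three multiplications by X
    raises the degree by one, beyond the linear [qfull]. *)
Lemma size_hpoly t : (2 <= t)%N -> size (hpoly t) = (t + 4)%N.
Proof.
move=> t2; have sq : (size (qfull t) <= 2)%N.
  rewrite (leq_trans (size_polyD _ _)) // geq_max size_poly1 /=.
  by rewrite (leq_trans (size_scale_leq _ _)) // size_polyX.
have sc : size (qcap t) = t.+1.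
  have e : (1 - 'X) = - ('X - 1%:P) :> {poly int} by rewrite opprB.
  have s1 : size ((1 - 'X : {poly int}) ^+ t) = t.+1.
    by rewrite e exprNn -signr_odd mulr_sign; case: ifP => _; rewrite ?size_polyN size_exp_XsubC.
  rewrite /qcap addrC size_polyDl size_polyN s1 //.
  by rewrite -[2%:R]polyC_natr (leq_ltn_trans (size_polyC_leq1 _)) //; lia.
have step (q : {poly int}) : (2 <= size q)%N -> size (qfull t + 'X * q) = (size q).+1.
  move=> q2; have qn0 : q != 0 by rewrite -size_poly_gt0; lia.
  by rewrite addrC mulrC size_polyDl size_mulX // (leq_ltn_trans sq) // size_mulX.
by rewrite /hpoly !step ?sc; lia.
Qed.

(** The value is 3t + 2. *)
Lemma hpoly1_neq0 t : (0 < t)%N -> (hpoly t).[1] != 0.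
Proof.
move=> t0; have q1 : (qfull t).[1] = t%:Z by rewrite /qfull !hornerE /=; lia.
have c1 : (qcap t).[1] = 2%:Z.
  by rewrite /qcap !hornerE subrr expr0n eqn0Ngt t0 subr0.
have e (a b : {poly int}) :
    (a + 'X * (a + 'X * (a + 'X * b))).[1] = a.[1] + a.[1] + a.[1] + b.[1].
  by rewrite !hornerE /=; ring.
by rewrite e q1 c1; lia.
Qed.

(** * Fibres of the toric map *)

Lemma mul_fmx (K : nzRingType) (A B : finType) (f : A -> B -> K)
    (a : 'rV[K]_#|A|) q :
  (a *m fmx f) 0 (enum_rank q) = \sum_p a 0 (enum_rank p) * f p q.
Proof.
rewrite mxE (reindex (@enum_rank A)) /=; last by apply: onW_bij; apply: enum_rank_bij.
by apply: eq_bigr => p _; rewrite mxE !enum_rankK.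
Qed.

Lemma mon_ext n d (m m' : mon n d) :
  (forall i, (val m i : nat) = val m' i) -> m = m'.
Proof. by move=> e; apply/val_inj/ffunP => i; apply/val_inj; apply: e. Qed.

Lemma mon_of n d (f : 'I_n -> nat) : (\sum_i f i = d)%N ->
  {m : mon n d | forall i, (val m i : nat) = f i}.
Proof.
move=> fd; have fle i : (f i < d.+1)%N by rewrite ltnS -fd (bigD1 i) //= leq_addr.
pose g : {ffun 'I_n -> 'I_d.+1} := [ffun i => inord (f i)].
have gE i : (g i : nat) = f i by rewrite ffunE inordK.
have gP : (\sum_(i < n) (g i : nat))%N == d.
  by apply/eqP; rewrite -[RHS]fd; apply: eq_bigr => i _.
by exists (Sub g gP) => i; rewrite SubK.
Qed.

Lemma mon_sum n d (m : mon n d) : (\sum_i (val m i : nat) = d)%N.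
Proof. exact/eqP/(valP m). Qed.

Lemma mon_mulx_ex n d (m : mon n d) (k : 'I_n) :
  {m' : mon n d.+1 | forall i, (val m' i : nat) = (val m i + (i == k))%N}.
Proof.
apply: mon_of; rewrite big_split /= mon_sum (bigD1 k) //= eqxx big1 ?addn1 //.
by move=> i /negPf->.
Qed.

Definition mon_mulx n d (m : mon n d) k : mon n d.+1 := sval (mon_mulx_ex m k).

Lemma mon_mulxE n d (m : mon n d) k i :
  (val (mon_mulx m k) i : nat) = (val m i + (i == k))%N.
Proof. exact: svalP (mon_mulx_ex m k) i. Qed.

(** * Koszul homology and Hilbert function through fibre sums *)

Section Bridge.
Variables (K : fieldType) (n nV : nat) (ends : nat -> nat * nat).
Variables (G : zmodType) (x : 'I_n -> G).

Definition rho d (m : mon n d) : G := \sum_k x k *+ (val m k : nat).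

Lemma rho_mulx d (m : mon n d) k : rho (mon_mulx m k) = rho m + x k.
Proof.
rewrite /rho (eq_bigr (fun i => x i *+ (val m i : nat) + x i *+ (i == k))); last first.
  by move=> i _; rewrite mon_mulxE mulrnDr.
rewrite big_split /=; congr (_ + _).
by rewrite (bigD1 k) //= eqxx big1 ?addr0 // => i /negPf->.
Qed.

Hypothesis ends_lt : forall k : 'I_n, ((ends k).1 < nV)%N /\ ((ends k).2 < nV)%N.
Hypothesis rho_edge : forall d (m m' : mon n d),
  rho m = rho m' <-> forall v : 'I_nV, edge_img ends m v = edge_img ends m' v.

Lemma edge_img_ex d (m : mon n d) :
  {c : mon nV (2 * d) | forall v, (val c v : nat) = edge_img ends m v}.
Proof.
apply: mon_of; rewrite /edge_img exchange_big /= -[in RHS](mon_sum m) mulnC big_distrl /=.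
apply: eq_bigr => e _; rewrite -big_distrr /= big_split /=; congr muln.
have one w : (w < nV)%N -> (\sum_(v < nV) (w == v :> nat) = 1)%N.
  move=> wn; rewrite (bigD1 (Ordinal wn)) //= eqxx big1 // => v.
  by rewrite -val_eqE /= eq_sym => /negPf->.
by rewrite !one //; case: (ends_lt e).
Qed.

Definition toric_img d (m : mon n d) : mon nV (2 * d) := sval (edge_img_ex m).

Lemma toric_imgE d (m : mon n d) v :
  (val (toric_img m) v : nat) = edge_img ends m v.
Proof. exact: svalP (edge_img_ex m) v. Qed.

Lemma toric_img_rho d (m m' : mon n d) :
  (toric_img m == toric_img m') = (rho m == rho m').
Proof.
apply/eqP/eqP => [e|/rho_edge e]; last by apply: mon_ext => v; rewrite !toric_imgE e.
by apply/rho_edge => v; rewrite -!toric_imgE e.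
Qed.

Lemma toric_entry d (m : mon n d) (c : mon nV (2 * d)) :
  (if [forall v : 'I_nV, (val c v : nat) == edge_img ends m v] then 1 else 0) =
  (c == toric_img m)%:R :> K.
Proof.
suff -> : [forall v : 'I_nV, (val c v : nat) == edge_img ends m v] = (c == toric_img m).
  by case: eqP.
apply/forallP/eqP => [h|-> v]; last by rewrite toric_imgE.
by apply: mon_ext => v; rewrite toric_imgE; apply/eqP.
Qed.

(** The columns of the toric matrix are indicators of fibres of [rho], so its kernel consists of the
    vectors whose sum over each fibre is 0. *)
Lemma ideal_memP d (v : 'rV[K]_#|mon n d|) :
  reflect (forall w, \sum_(m | rho m == w) v 0 (enum_rank m) = 0)
    (v <= toric_ideal_deg K n nV ends d)%MS.
Proof.
have E c : (v *m toric_mx K n nV ends d) 0 (enum_rank c) =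
    \sum_(m | c == toric_img m) v 0 (enum_rank m).
  rewrite mul_fmx [RHS]big_mkcond; apply: eq_bigr => m _; rewrite toric_entry.
  by case: eqP; rewrite ?mulr1 ?mulr0.
apply: (iffP sub_kermxP) => [v0 w|h].
  have [/existsP[m0 /eqP <-]|] := boolP [exists m : mon n d, rho m == w].
    have := E (toric_img m0); rewrite v0 mxE => e; rewrite [RHS]e.
    by apply: eq_bigl => m; rewrite toric_img_rho eq_sym.
  move=> /existsPn nw; apply: big1 => m; by rewrite (negPf (nw m)).
apply/rowP => j; rewrite -(enum_valK j) E mxE.
have [/existsP[m0 /eqP ->]|] := boolP [exists m, enum_val j == toric_img m].
  by rewrite -[RHS](h (rho m0)); apply: eq_bigl => m; rewrite toric_img_rho eq_sym.
by move=> /existsPn nw; apply: big1 => m; rewrite (negPf (nw m)).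
Qed.

(** Summing over the fibre above [w] is passage to the quotient by the toric ideal: [chain v] is the
    image of [v] in the Koszul complex of K[G]. *)
Definition chain i d (v : 'rV[K]_#|kos n i d|) (S : {set 'I_n}) (w : G) : K :=
  \sum_(p : kos n i d | (val p.1 == S) && (rho p.2 == w)) v 0 (enum_rank p).

Lemma chainB i d (u v : 'rV[K]_#|kos n i d|) S w :
  chain (u - v) S w = chain u S w - chain v S w.
Proof. by rewrite /chain -sumrB; apply: eq_bigr => p _; rewrite !mxE. Qed.

Lemma chain_slice i d (v : 'rV[K]_#|kos n i d|) (s : {S : {set 'I_n} | #|S| == i}) w :
  chain v (val s) w = \sum_(m | rho m == w) v 0 (enum_rank (s, m)).
Proof.
rewrite /chain (eq_bigr (fun p => v 0 (enum_rank (p.1, p.2)))) => [|[]//].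
rewrite -(pair_big_dep (fun s' : {S : {set 'I_n} | #|S| == i} => val s' == val s)
  (fun _ (m : mon n d) => rho m == w) (fun s' m => v 0 (enum_rank (s', m)))) /=.
by rewrite (big_pred1 s) // => s'.
Qed.

Lemma chain_card i d (v : 'rV[K]_#|kos n i d|) (S : {set 'I_n}) w :
  #|S| != i -> chain v S w = 0.
Proof.
move=> Si; apply: big1 => p /andP[/eqP pS _].
by have := valP p.1; rewrite /= pS (negPf Si).
Qed.

Lemma kos_ideal_memP i d (v : 'rV[K]_#|kos n i d|) :
  reflect (forall S w, chain v S w = 0) (v <= kos_ideal_mx K n nV ends i d)%MS.
Proof.
pose I := toric_ideal_deg K n nV ends d.
pose A : finType := ({S : {set 'I_n} | #|S| == i} * 'I_#|mon n d|)%type.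
have E (a : 'rV[K]_#|A|) s m :
    (a *m kos_ideal_mx K n nV ends i d) 0 (enum_rank (s, m)) =
    ((\row_j a 0 (enum_rank (s, j))) *m I) 0 (enum_rank m).
  rewrite mul_fmx mxE /=.
  rewrite (eq_bigr (fun p => a 0 (enum_rank (p.1, p.2)) *
      (if p.1 == s then I p.2 (enum_rank m) else 0))) => [|[]//].
  rewrite -(pair_bigA _ (fun s' j => a 0 (enum_rank (s', j)) *
      (if s' == s then I j (enum_rank m) else 0))) /=.
  rewrite (bigD1 s) //= [X in _ + X]big1 ?addr0 => [|s' /negPf e].
    by apply: eq_bigr => j _; rewrite eqxx mxE.
  by apply: big1 => j _; rewrite e mulr0.
pose slice s : 'rV[K]_#|mon n d| := \row_j v 0 (enum_rank (s, enum_val j)).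
have sliceE s m : slice s 0 (enum_rank m) = v 0 (enum_rank (s, m)).
  by rewrite mxE enum_rankK.
apply: (iffP idP) => [/submxP[a va] S w|h].
  have [Si|Si] := boolP (#|S| == i); last exact: chain_card.
  rewrite -[S]/(val (Sub S Si : {S : {set 'I_n} | #|S| == i})) chain_slice.
  set s := Sub S Si.
  have /ideal_memP/(_ w) : (slice s <= I)%MS.
    apply/submxP; exists (\row_j a 0 (enum_rank (s, j))).
    by apply/rowP => j; rewrite -(enum_valK j) -E -va sliceE.
  by move=> h; rewrite -[RHS]h; apply: eq_bigr => m _; rewrite sliceE.
have sI s : (slice s <= I)%MS.
  apply/ideal_memP => w; rewrite -[RHS](h (val s) w) chain_slice.
  by apply: eq_bigr => m _; rewrite sliceE.
(* Each slice lies in the row space of [I], and the pseudo-inverse supplies its coefficients. *)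
apply/submxP; exists (\row_p (slice (enum_val p).1 *m pinvmx I) 0 (enum_val p).2).
apply/rowP => j; rewrite -(enum_valK j); case: (enum_val j) => s m.
rewrite E -sliceE -[in LHS](mulmxKpV (sI s)); congr ((_ *m _) _ _).
by apply/rowP => l; rewrite !mxE enum_rankK.
Qed.

Lemma chain_koszul i d (v : 'rV[K]_#|kos n i.+1 d|) S w :
  chain (v *m koszul_mx K n i d) S w = bd x (chain v) S w.
Proof.
have q0P (p : kos n i.+1 d) k : k \in val p.1 -> #|val p.1 :\ k| == i.
  by move=> kp; have := valP p.1; rewrite /= (cardsD1 k) kp add1n eqSS.
(* Both sides become a sum over a basis element and a removed edge [k]; the pair determines a unique
   target [q0]. *)
transitivity (\sum_(p : kos n i.+1 d) \sum_(k in val p.1)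
   if (val p.1 :\ k == S) && (rho p.2 + x k == w)
   then v 0 (enum_rank p) * (-1) ^+ #|[set l in val p.1 | (l < k)%N]| else 0).
  rewrite /chain (eq_bigr _ (fun q _ => mul_fmx _ _ q)) exchange_big /=.
  apply: eq_bigr => p _; rewrite -mulr_sumr exchange_big /= mulr_sumr.
  apply: eq_bigr => k kp.
  pose q0 : kos n i d.+1 := (Sub (val p.1 :\ k) (q0P p k kp), mon_mulx p.2 k).
  rewrite big_mkcond (bigD1 q0) //= [X in _ + X]big1 ?addr0.
    rewrite eqxx /= rho_mulx; case: ifP => _; last by rewrite mulr0.
    by case: ifPn => // /forallPn[l]; rewrite mon_mulxE eqxx.
  move=> q qq0; case: ifP => // _; case: ifP => // /andP[/eqP q1 /forallP q2].
  case/negP: qq0; apply/eqP; case: q q1 q2 => q1 q2 /= e1 e2; congr (_, _).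
    exact/val_inj.
  by apply: mon_ext => l; rewrite mon_mulxE; apply/eqP.
rewrite /bd (eq_bigr (fun p : kos n i.+1 d => \sum_(k | k \notin S)
   if (val p.1 == k |: S) && (rho p.2 == w - x k)
   then ksign K k S * v 0 (enum_rank p) else 0)); last first.
  move=> p _; rewrite big_mkcond [RHS]big_mkcond; apply: eq_bigr => k _.
  have [kp|kp] := boolP (k \in val p.1); last first.
    rewrite (_ : (val p.1 == k |: S) = false) ?if_same //.
    by apply: contraNF kp => /eqP ->; apply: setU11.
  have [kS|kS] /= := boolP (k \in S).
    by case: eqP => // SE; rewrite -SE setD11 in kS.
  have -> : (val p.1 :\ k == S) = (val p.1 == k |: S).
    by apply/eqP/eqP => [<-|->]; rewrite ?setD1K ?setU1K.
  rewrite -subr_eq opprK.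
  case: eqP => //= ->; case: ifP => // _; rewrite mulrC; congr (_ * _).
  by rewrite -[LHS]/(ksign K k (k |: S)) ksign_setU1 // ltnn expr0 mul1r.
rewrite exchange_big /=; apply: eq_bigr => k kS.
by rewrite -big_mkcond /= mulr_sumr.
Qed.

(** One chosen monomial in each fibre carries the whole value, the other monomials get 0. *)
Lemma chain_lift i d (u : {set 'I_n} -> G -> K) :
  exists v : 'rV[K]_#|kos n i d|,
    forall (S : {set 'I_n}) (m : mon n d), #|S| = i -> chain v S (rho m) = u S (rho m).
Proof.
pose sel (w : G) := [pick m : mon n d | rho m == w].
exists (\row_j let p := enum_val j in
  if sel (rho p.2) == Some p.2 then u (val p.1) (rho p.2) else 0) => S m /eqP Si.
rewrite -[S]/(val (Sub S Si : {S : {set 'I_n} | #|S| == i})) chain_slice.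
rewrite (eq_bigr (fun m' => if Some m' == sel (rho m) then u S (rho m) else 0)); last first.
  by move=> m' /eqP e; rewrite mxE enum_rankK /= e eq_sym.
rewrite -big_mkcondr /=.
rewrite /sel; case: pickP => [m0 /eqP e0|/(_ m)]; last by rewrite eqxx.
rewrite (big_pred1 m0) // => m' /=.
apply/andP/eqP => [[_ /eqP[]]//|->]; by rewrite e0 !eqxx.
Qed.


Variables (L : pred G) (deg : G -> int).
Hypothesis deg_x : forall w k, deg (w + x k) = deg w + 1.
Hypothesis live_rho : forall d (m : mon n d), L (rho m).
Hypothesis deg_rho : forall d (m : mon n d), deg (rho m) = d.
Hypothesis rho_onto : forall (d : nat) w, L w -> deg w = d ->
  exists m : mon n d, rho m = w.

Lemma chain_notin i d (v : 'rV[K]_#|kos n i d|) S w :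
  (forall m : mon n d, rho m != w) -> chain v S w = 0.
Proof. by move=> nw; apply: big1 => p /andP[_]; rewrite (negPf (nw p.2)). Qed.

Lemma supp_chain i d (v : 'rV[K]_#|kos n i d|) : supp L (chain v).
Proof.
move=> S w nLw; apply: chain_notin => m; apply: contraNneq nLw => <-.
exact: live_rho.
Qed.

Lemma cycles_dimE i d : exists2 C : 'M[K]_#|kos n i d|,
  kos_cycles_dim K n nV ends i d = \rank C &
  forall v : 'rV_#|kos n i d|,
    (v <= C)%MS <-> forall S w, bd x (chain v) S w = 0.
Proof.
case: i => [|i] /=.
  (* In homological degree 0 every vector is a cycle, because its chain vanishes on nonempty
     sets. *)
  exists 1%:M => [|v]; first by rewrite mxrank1.
  rewrite submx1; split=> // _ S w; apply: big1 => k kS.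
  by rewrite chain_card ?mulr0 // cardsU1 kS.
exists (kermx (koszul_mx K n i d *m cokermx (kos_ideal_mx K n nV ends i d.+1))) => // v.
rewrite (sameP sub_kermxP eqP) mulmxA -submxE.
split=> [/kos_ideal_memP h S w|h]; first by rewrite -chain_koszul h.
by apply/kos_ideal_memP => S w; rewrite chain_koszul h.
Qed.

Lemma boundsP i d (v : 'rV[K]_#|kos n i d.+1|) :
  reflect (exists u : 'rV[K]_#|kos n i.+1 d|,
      forall S w, chain v S w = bd x (chain u) S w)
    (v <= (koszul_mx K n i d + kos_ideal_mx K n nV ends i d.+1)%MS)%MS.
Proof.
apply: (iffP sub_addsmxP) => [[[u a] /= va]|[u vu]].
  exists u => S w; rewrite -chain_koszul; apply/eqP; rewrite -subr_eq0 -chainB.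
  rewrite va addrC addKr; apply/eqP; move: S w; apply/kos_ideal_memP.
  exact: submxMl.
have /submxP[a va] : (v - u *m koszul_mx K n i d <= kos_ideal_mx K n nV ends i d.+1)%MS.
  by apply/kos_ideal_memP => S w; rewrite chainB chain_koszul vu subrr.
by exists (u, a); rewrite /= -va addrC subrK.
Qed.

Lemma betti_eq0 i d : exact_at K x deg d.+1 L -> betti K n nV ends i d.+1 = 0%N.
Proof.
move=> ex; rewrite /betti; have [C -> memC] := cycles_dimE i d.+1.
apply/eqP; rewrite subn_eq0 mxrankS //; apply/row_subP => j.
set v := row j C; have /memC bv : (v <= C)%MS by apply: row_sub.
have [u su vu] := ex (chain v) (supp_chain v) (fun S w _ _ => bv S w).
(* Exactness gives a primitive with components in all homological and internal degrees; only those
   in homological degree [i.+1] and degree [d] are lifted, and only these matter for sets of size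
   [i]. *)
have [u' uu'] := @chain_lift i.+1 d u; apply/boundsP; exists u' => S w.
have [Si|Si] := eqVneq #|S| i; last first.
  rewrite chain_card //; symmetry; apply: big1 => k kS.
  by rewrite chain_card ?mulr0 // cardsU1 kS add1n eqSS.
have [/existsP[m /eqP mw]|/existsPn nw] := boolP [exists m : mon n d.+1, rho m == w].
  have Lw : L w by rewrite -mw.
  have dw : deg w = d.+1 by rewrite -mw.
  rewrite vu //; apply: eq_bd => k kS.
  have [Lv|nLv] := boolP (L (w - x k)); last by rewrite su // supp_chain.
  have [|m' mE] := rho_onto (d := d) Lv; last by rewrite -mE uu' // cardsU1 kS Si.
  by rewrite (deg_subx deg_x) dw -addn1 PoszD addrK.
rewrite chain_notin //; symmetry; apply: big1 => k kS; rewrite chain_notin ?mulr0 // => m.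
by apply: contraNneq (nw (mon_mulx m k)) => e; rewrite rho_mulx e subrK.
Qed.

(** Boundaries are cycles because [bd] squares to 0, and [v] makes the inclusion strict, hence the
    ranks differ. *)
Lemma betti_neq0 i d (v : 'rV[K]_#|kos n i d.+1|) :
  (forall S w, bd x (chain v) S w = 0) ->
  (forall u : 'rV[K]_#|kos n i.+1 d|,
     ~ forall S w, chain v S w = bd x (chain u) S w) ->
  betti K n nV ends i d.+1 != 0%N.
Proof.
move=> bv nv; have [C CE memC] := cycles_dimE i d.+1.
rewrite /betti CE subn_eq0 -ltnNge /=.
set B := (_ + _)%MS; have BC : (B <= C)%MS.
  apply/row_subP => j; have /boundsP[u ju] : (row j B <= B)%MS by apply: row_sub.
  apply/memC => S w; rewrite -[RHS](bd_bd x (chain u) S w).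
  by apply: eq_bd => k _; rewrite ju.
have : (B < C)%MS.
  rewrite ltmxE BC; apply: contraPN ((memC v).2 bv) => CB vC.
  by have /boundsP[u vu] := submx_trans vC CB; exact: nv vu.
by rewrite ltmxErank => /andP[].
Qed.

Lemma hilb_funE d s : layer deg L (Posz d) s -> hilb_fun K n nV ends d = size s.
Proof.
case=> us ms; rewrite /hilb_fun mxrank_ker subKn ?rank_leq_row //.
have rep_ex (j : 'I_(size s)) : {m : mon n d | rho m == nth 0 s j}.
  apply: sigW; have : nth 0 s j \in s by rewrite mem_nth.
  by rewrite ms => /andP[Lw /eqP/(rho_onto Lw)[m <-]]; exists m.
pose rep j := sval (rep_ex j).
have repE j : rho (rep j) = nth 0 s j by apply/eqP/(svalP (rep_ex j)).
pose T := toric_mx K n nV ends d.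
have TE i j : T i j = (enum_val j == toric_img (enum_val i))%:R.
  by rewrite mxE toric_entry.
(* The rank is found by factoring [T] as [P *m D]: [D] keeps one row per fibre and [P] sends each
   monomial to its fibre. The rows of [D] are independent since distinct fibres have distinct toric
   images. *)
pose D := rowsub (fun j => enum_rank (rep j)) T.
pose P : 'M[K]_(#|mon n d|, size s) := \matrix_(i, j) (rho (enum_val i) == nth 0 s j)%:R.
have TPD : T = P *m D.
  apply/matrixP => i c; rewrite [RHS]mxE.
  have rs : rho (enum_val i) \in s by rewrite ms live_rho deg_rho eqxx.
  have js : (index (rho (enum_val i)) s < size s)%N by rewrite index_mem.
  rewrite (bigD1 (Ordinal js)) //= big1 => [|j jn]; last first.
    rewrite mxE; case: eqP => [e|]; last by rewrite mul0r.
    case/eqP: jn; apply: val_inj; by rewrite /= e index_uniq.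
  rewrite !mxE /= nth_index // eqxx mul1r addr0 enum_rankK !toric_entry.
  suff -> : toric_img (enum_val i) = toric_img (rep (Ordinal js)) by [].
  by apply/eqP; rewrite toric_img_rho repE /= nth_index.
have Dfree : row_free D.
  apply/row_freeP; exists (\matrix_(c, j) (c == enum_rank (toric_img (rep j)))%:R).
  apply/matrixP => i j; rewrite !mxE (bigD1 (enum_rank (toric_img (rep j)))) //=.
  rewrite big1 => [|c /negPf cn]; last by rewrite [X in _ * X]mxE cn mulr0.
  rewrite [X in _ * X]mxE eqxx mulr1 addr0 mxE TE !enum_rankK toric_img_rho !repE.
  by rewrite nth_uniq // eq_sym.
apply/eqP; rewrite eqn_leq -{2}(eqP Dfree); apply/andP; split.
  by rewrite -/T TPD (leq_trans (mxrankM_maxl _ _)) // rank_leq_col.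
have -> : D = (\matrix_(j, i) (i == enum_rank (rep j))%:R) *m T.
  apply/matrixP => j c; rewrite [RHS]mxE (bigD1 (enum_rank (rep j))) //= big1.
    by rewrite addr0 [LHS]mxE [X in _ = X * _]mxE eqxx mul1r.
  by move=> i /negPf e; rewrite mxE e mul0r.
exact: mxrankM_maxr.
Qed.

End Bridge.

(** * The edge monoid as the image of the toric map *)

Lemma additive_rho n (G : zmodType) (x : 'I_n -> G) (f : G -> int) d (m : mon n d) :
  {morph f : a b / a + b} -> f (rho x m) = \sum_k f (x k) *+ (val m k : nat).
Proof.
move=> fD; have f0 : f 0 = 0 by apply: (addrI (f 0)); rewrite -fD !addr0.
rewrite /rho (big_morph f fD f0); apply: eq_bigr => k _.
by elim: (val m k : nat) => [|j IH]; rewrite ?mulr0n // !mulrS fD IH.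
Qed.

Section Toric.
Variable t : nat.
Notation x := (@gen t).

Lemma wtD : {morph @wt t : a b / a + b}.
Proof.
elim/lat_elim => e2 e3 f1 f2 f3 al y; elim/lat_elim => e2' e3' f1' f2' f3' al' y'.
rewrite vecD /= ysumD; ring.
Qed.

Lemma wt_rho d (m : mon (Gt_nE t) d) : wt (rho x m) = d.
Proof.
rewrite (additive_rho _ _ wtD) -[in RHS](mon_sum m) -natz natr_sum.
apply: eq_bigr => k _; rewrite natz; have := wt_gen 0 k.
by rewrite add0r => ->; rewrite /= ysum0 natz.
Qed.

Lemma monoid0 : in_monoid (0 : lat t).
Proof.
apply/monoidP; exists 0%N; rewrite e1mul0 subr0 /= ysum0 lexx andbT.
by apply/forallP => j; rewrite ffunE eqxx implybT.
Qed.

Lemma monoid_rho d (m : mon (Gt_nE t) d) : in_monoid (rho x m).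
Proof.
suff h (u : lat t) : in_monoid u -> in_monoid (u + rho x m).
  by rewrite -[rho _ _]add0r; apply/h/monoid0.
move: u; rewrite /rho.
apply: (big_ind (fun w : lat t => forall u : lat t, in_monoid u -> in_monoid (u + w))).
- by move=> u; rewrite addr0.
- by move=> w w' h h' u /h/h'; rewrite addrA.
move=> k _; elim: (val m k : nat) => [|j IH] u mu; first by rewrite addr0.
by rewrite mulrS addrA; apply/IH/monoid_x.
Qed.

(** This is the descent showing that the edges generate the monoid. Strip e1 if it is used,
    otherwise another triangle edge with positive exponent, otherwise a_i or b_i at some [y i >= 1],
    according to whether [al] is positive. *)
Lemma monoid_pred w : in_monoid w -> w = 0 \/ exists k, in_monoid (w - x k).
Proof.
case/monoidP => -[|j]; last first.
  have [k kE] := edge_ef t (inord 3); rewrite inordK //= in kE.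
  move=> h; right; exists k; apply/monoidP; exists j.
  by rewrite kE -addrA -opprD (addrC (vec _ _ _ _ _ _ _)) -e1mulS.
rewrite e1mul0 subr0.
have nn k : live t p_nneg (w - x k) -> w = 0 \/ exists k, in_monoid (w - x k).
  by move=> h; right; exists k; apply/monoidP; exists 0%N; rewrite e1mul0 subr0.
have [kf1 f1E] := edge_ef t (inord 0).
have [kf2 f2E] := edge_ef t (inord 1).
have [kf3 f3E] := edge_ef t (inord 2).
have [ke2 e2E] := edge_ef t (inord 4).
have [ke3 e3E] := edge_ef t (inord 5).
rewrite inordK //= in f1E; rewrite inordK //= in f2E; rewrite inordK //= in f3E.
rewrite inordK //= in e2E; rewrite inordK //= in e3E.
move: nn (nn kf1) (nn kf2) (nn kf3) (nn ke2) (nn ke3).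
rewrite f1E f2E f3E e2E e3E; elim/lat_elim: w => e2 e3 f1 f2 f3 al y.
rewrite !vecB !live_vec !subr0 /p_nneg.
move=> nn h1 h2 h3 h4 h5 /and3P[pe yp ya]; rewrite yp in h1 h2 h3 h4 h5.
have [c1|c1] := boolP (1 <= f1); first by apply: h1; lia.
have [c2|c2] := boolP (1 <= f2); first by apply: h2; lia.
have [c3|c3] := boolP (1 <= f3); first by apply: h3; lia.
have [c4|c4] := boolP (1 <= e2); first by apply: h4; lia.
have [c5|c5] := boolP (1 <= e3); first by apply: h5; lia.
have [/existsP[i yi]|/existsPn y0] := boolP [exists i, 1 <= y i].
  have [al1|al0] := boolP (1 <= al).
    have [k kE] := edge_a i; apply: (nn k).
    rewrite kE vecB live_vec !subr0 ypos_sub // yp yi ysumD ysumN ysum_delta // /p_nneg.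
    by move: pe; lia.
  have [k kE] := edge_b i; apply: (nn k).
  have := ypos_ysum i yp; move: yi; move E : (y i : int) => z yi zy.
  rewrite kE vecB live_vec !subr0 ypos_sub // yp E yi ysumD ysumN ysum_delta // /p_nneg.
  by move: pe; lia.
have {}y0 : y = 0.
  apply/ffunP => i; rewrite ffunE; have := ypos_ysum i yp; have := y0 i.
  by move: (y i : int) => z; lia.
left; rewrite y0 ysum0 in ya *.
have -> : al = 0 by lia.
have -> : e2 = 0 by lia.
have -> : e3 = 0 by lia.
have -> : f1 = 0 by lia.
have -> : f2 = 0 by lia.
by have -> : f3 = 0 by lia.
Qed.

Lemma rho_monoid_onto (d : nat) w : in_monoid w -> wt w = d ->
  exists m : mon (Gt_nE t) d, rho x m = w.
Proof.
elim: d w => [|d IH] w mw dw; have [w0|[k mk]] := monoid_pred mw.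
- have [|m m0] := @mon_of (Gt_nE t) 0 (fun=> 0%N); first by rewrite big1.
  by exists m; rewrite w0; apply: big1 => i _; rewrite m0.
- have := wt_monoid mk; rewrite (deg_subx (@wt_gen t)) dw //.
- by move: dw; rewrite w0 /= ysum0.
have [|m mE] := IH _ mk; last by exists (mon_mulx m k); rewrite rho_mulx mE subrK.
by rewrite (deg_subx (@wt_gen t)) dw -addn1 PoszD addrK.
Qed.

(** Extends [y] by 0 to all natural indices, so that [vtx] needs no bound on the vertex. *)
Definition yat (y : {ffun 'I_t -> int}) (i : nat) : int := \sum_(j < t | (j : nat) == i) y j.

(* Vertices numbered as in [Gt_ends]: x1, x2, z1, z2, w1, w2, y_1, ... *)
Definition vtx (v : nat) (w : lat t) : int :=
  let: (e2, e3, f1, f2, f3, al, y) := w in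
  match v with
  | 0 => al + e3 | 1 => ysum y - al + f1 + f3 | 2 => e2 | 3 => e2 + e3
  | 4 => f1 + f2 | 5 => f2 + f3 | i.+4.+2 => yat y i
  end.

Lemma yatD y y' i : yat (y + y') i = yat y i + yat y' i.
Proof. by rewrite /yat -big_split; apply: eq_bigr => j _; rewrite ffunE. Qed.

Lemma yat0 i : yat 0 i = 0.
Proof. by apply: big1 => j _; rewrite ffunE. Qed.

Lemma yat_ord y (i : 'I_t) : yat y i = y i.
Proof. by rewrite /yat (big_pred1 i) // => j. Qed.

Lemma yat_delta k i : (k < t)%N -> yat (ydelta t k) i = (k == i)%:Z.
Proof.
move=> kt; rewrite /yat; have [<-|ki] := eqVneq k i.
  by rewrite (big_pred1 (Ordinal kt)) ?ffunE ?eqxx // => j.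
apply: big1 => j /eqP ji; rewrite ffunE; case: eqP => // e.
by rewrite -e ji eqxx in ki.
Qed.

Lemma vtxD v : {morph vtx v : a b / a + b}.
Proof.
elim/lat_elim => e2 e3 f1 f2 f3 al y; elim/lat_elim => e2' e3' f1' f2' f3' al' y'.
rewrite vecD; move: v => [|[|[|[|[|[|i]]]]]] /=; rewrite ?ysumD ?yatD; ring.
Qed.

Lemma vtx_gen v (k : 'I_(Gt_nE t)) :
  vtx v (x k) = (((Gt_ends t k).1 == v) + ((Gt_ends t k).2 == v))%N.
Proof.
rewrite /gen /edge_vec /Gt_ends; have := ltn_ord k; move: (k : nat) => {}k; rewrite /Gt_nE => kn.
case: ifP => kt.
  by move: v => [|[|[|[|[|[|i]]]]]] //=; rewrite ?ysum_delta ?yat_delta.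
do 6 (case: eqP => [_|?]; first
  by move: v => [|[|[|[|[|[|i]]]]]] //=; rewrite ?ysum0 ?yat0).
have kt' : (k - (t + 6) < t)%N by lia.
by move: v => [|[|[|[|[|[|i]]]]]] //=; rewrite ?ysum_delta ?yat_delta.
Qed.

(** The vertices y_i give [y], then z1, z2 and x1 give e2, e3 and [al]. What remains are the
    pairwise sums of f1, f2, f3, which determine them because the triangle is an odd cycle. *)
Lemma vtx_inj (w w' : lat t) :
  (forall v, (v < Gt_nV t)%N -> vtx v w = vtx v w') -> w = w'.
Proof.
elim/lat_elim: w => e2 e3 f1 f2 f3 al y; elim/lat_elim: w' => e2' e3' f1' f2' f3' al' y'.
rewrite /Gt_nV => h.
have h6 v : (v < 6)%N -> _ := fun v6 => h v (ltn_addl t v6).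
have /= g0 := h6 0%N isT; have /= g1 := h6 1%N isT; have /= g2 := h6 2%N isT.
have /= g3 := h6 3%N isT; have /= g4 := h6 4%N isT; have /= g5 := h6 5%N isT.
have yy : y = y'.
  apply/ffunP => i; rewrite -!yat_ord; have := h (6 + i)%N; apply.
  by rewrite addnC ltn_add2r.
rewrite yy in g1 *; congr vec; lia.
Qed.

Lemma vtx_rho v d (m : mon (Gt_nE t) d) :
  vtx v (rho x m) = edge_img (Gt_ends t) m v.
Proof.
rewrite (additive_rho _ _ (@vtxD v)) /edge_img -natz natr_sum.
by apply: eq_bigr => k _; rewrite vtx_gen natz -mulr_natl natz -PoszM.
Qed.

Lemma rho_edge_img d (m m' : mon (Gt_nE t) d) : rho x m = rho x m' <->
  forall v : 'I_(Gt_nV t), edge_img (Gt_ends t) m v = edge_img (Gt_ends t) m' v.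
Proof.
split=> [e v|h]; first by have := vtx_rho v m; rewrite e vtx_rho => -[].
by apply: vtx_inj => v vn; rewrite !vtx_rho (h (Ordinal vn)).
Qed.

Lemma Gt_ends_lt (k : 'I_(Gt_nE t)) :
  ((Gt_ends t k).1 < Gt_nV t)%N /\ ((Gt_ends t k).2 < Gt_nV t)%N.
Proof.
have := ltn_ord k; rewrite /Gt_ends /Gt_nV /Gt_nE => kn.
by do 7 (case: ifP => ? /=; first by split; lia); split; lia.
Qed.

End Toric.

(** * The quintic generator *)

Section Quintic.
Variables (K : fieldType) (t : nat).
Hypothesis t0 : (0 < t)%N.
Notation x := (@gen t).

(** The multidegree shared by e1 e3 f2 b_1^2 and e2 f1 f3 a_1^2, the quintic with i = j = 1;
    [left_edge] below picks the variables of the first monomial. *)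
Definition top_deg : lat t := vec 1 0 1 0 1 2 (ydelta t 0 + ydelta t 0).

Definition left_edge (k : 'I_(Gt_nE t)) : bool :=
  x k \in [:: vec 1 (-1) 1 (-1) 1 2 0; vec 0 1 0 0 0 0 0; vec 0 0 0 1 0 0 0;
              vec 0 0 0 0 0 0 (ydelta t 0)].

Lemma ysumB (y y' : {ffun 'I_t -> int}) : ysum (y - y') = ysum y - ysum y' :> int.
Proof. by rewrite ysumD ysumN. Qed.

(** No monomial of this multidegree mixes variables of the two sides. For a left edge against some
    b_i other than b_1 the exponent of y_i would be negative; the other cases violate the sign, cap
    or parity constraints on the remaining coordinates. *)
Lemma top_deg_cut k l : left_edge k -> ~~ left_edge l ->
  ~~ in_monoid (top_deg - x k - x l).
Proof.
move=> kT lT; have nB i : x l = vec 0 0 0 0 0 0 (ydelta t i) -> i <> 0%N.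
  by move=> e i0; case/negP: lT; rewrite /left_edge e i0 !inE eqxx !orbT.
have nE1 : x l <> vec 1 (-1) 1 (-1) 1 2 0.
  by move=> e; case/negP: lT; rewrite /left_edge e !inE eqxx.
have nE3 : x l <> vec 0 1 0 0 0 0 0.
  by move=> e; case/negP: lT; rewrite /left_edge e !inE eqxx !orbT.
have nF2 : x l <> vec 0 0 0 1 0 0 0.
  by move=> e; case/negP: lT; rewrite /left_edge e !inE eqxx !orbT.
apply/negP => /monoidP[j]; move: kT; rewrite /left_edge !inE => kT.
have yE := (ysumB, ysumD, ysum0 t, ysum_delta t0).
move: kT; move: (x k) => a kT; clear k; move: nB nE1 nE3 nF2; clear lT.
rewrite /gen; case: (edge_vecP (ltn_ord l)) => [i it|i it||||||] nB nE1 nE3 nF2 //;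
  clear l; rewrite /top_deg /e1mul.
- clear nB nE1 nE3 nF2.
  case/or4P: kT => /eqP ->; rewrite !vecB live_vec !yE ysum_delta // /p_nneg; lia.
- have i0 := nB i erefl; clear nB nE1 nE3 nF2.
  suff ny a' : ~~ ypos t (ydelta t 0 + ydelta t 0 - ydelta t a' - ydelta t i - 0) /\
               ~~ ypos t (ydelta t 0 + ydelta t 0 - 0 - ydelta t i - 0).
    by case/or4P: kT => /eqP ->; rewrite !vecB live_vec; case: (ny 0%N) => /negPf n1 /negPf n2;
      rewrite ?n1 ?n2 ?andbF.
  split; apply/negP => /forallP/(_ (Ordinal it)); rewrite !ffunE eqxx /=;
  by case: eqP => // _; case: eqP.
- clear nB nE1 nE3 nF2.
  case/or4P: kT => /eqP ->; rewrite !vecB live_vec !yE // /p_nneg; lia.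
- clear nB nE1 nE3 nF2.
  case/or4P: kT => /eqP ->; rewrite !vecB live_vec !yE // /p_nneg; lia.
- clear nB nE1 nE3 nF2.
  case/or4P: kT => /eqP ->; rewrite !vecB live_vec !yE // /p_nneg; lia.
Qed.

(** The second index is internal minus homological degree, so a minimal generator of degree 5
    appears at (1, 4). *)
Lemma betti14_neq0 : betti K (Gt_nE t) (Gt_nV t) (Gt_ends t) 1 4 != 0%N.
Proof.
have [k1 k1E] := edge_ef t (inord 3); rewrite inordK //= in k1E.
have [k2 k2E] := edge_ef t (inord 4); rewrite inordK //= in k2E.
have k12 : k1 != k2 by apply/eqP => e; move: k1E; rewrite e k2E => -[].
have [a1 a1E] : {a | a = top_deg - x k1} by exists (top_deg - x k1).
have [a2 a2E] : {a | a = top_deg - x k2} by exists (top_deg - x k2).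
(* The Koszul cycle of the quintic: e1 paired with e3 f2 b_1^2, minus e2 paired with f1 f3 a_1^2.
   The two products agree in K[G_t]. *)
pose u S w : K := if (S == [set k1]) && (w == a1) then 1
  else if (S == [set k2]) && (w == a2) then -1 else 0.
have u0 S w : u S w != 0 -> #|S| = 1%N /\ exists m : mon (Gt_nE t) 4, rho x m = w.
  have on w' : live t p_nneg w' -> wt w' = 4 -> exists m : mon (Gt_nE t) 4, rho x m = w'.
    move=> lw; apply: rho_monoid_onto; apply/monoidP; exists 0%N.
    by rewrite e1mul0 subr0.
  have yp : ypos t (ydelta t 0 + ydelta t 0).
    by apply/forallP => j; rewrite !ffunE leqNgt ltn_ord /=; case: eqP.
  rewrite /u; case: ifP => [/andP[/eqP-> /eqP->] _|_].
    rewrite cards1; split=> //; apply: on; rewrite a1E k1E /top_deg vecB ?live_vec ?subr0;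
    by rewrite /= ?yp ysumD ysum_delta.
  case: ifP => [/andP[/eqP-> /eqP->] _|_]; last by rewrite eqxx.
  rewrite cards1; split=> //; apply: on; rewrite a2E k2E /top_deg vecB ?live_vec ?subr0;
  by rewrite /= ?yp ysumD ysum_delta.
have [v vu] := @chain_lift K _ _ x 1 4 u.
have {}vu S w : chain x v S w = u S w.
  have [uz|/u0[S1 [m <-]]] := eqVneq (u S w) 0; last exact: vu.
  have [S1|S1] := eqVneq #|S| 1%N; last by rewrite chain_card // uz.
  have [/existsP[m /eqP mw]|/existsPn nw] := boolP [exists m : mon (Gt_nE t) 4, rho x m == w].
    by rewrite -mw vu.
  by rewrite chain_notin.
have left1 : left_edge k1 by rewrite /left_edge k1E !inE eqxx.
have nleft2 : ~~ left_edge k2.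
  by rewrite /left_edge k2E; apply/negP; rewrite !inE => /or4P[] /eqP[].
have uset k w : u [set k] w = if (k == k1) && (w == a1) then 1
    else if (k == k2) && (w == a2) then -1 else 0.
  by rewrite /u !(inj_eq set1_inj).
clearbody u.
apply: (betti_neq0 (@Gt_ends_lt t) (@rho_edge_img t) (v := v)) => [S w|z vz].
  rewrite (eq_bd (c2 := u)) => [|k _]; last exact: vu.
  have [->|S0] := eqVneq S set0; last first.
    apply: big1 => k kS; have [->|/u0[+ _]] := eqVneq (u (k |: S) (w - x k)) 0.
      by rewrite mulr0.
    by rewrite cardsU1 kS => -[/eqP]; rewrite cards_eq0 (negPf S0).
  rewrite /bd (bigD1 k1) ?inE //= (bigD1 k2) /=; last by rewrite inE eq_sym k12.
  rewrite big1 => [|k /andP[/andP[_ /negPf e1] /negPf e2]]; last first.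
    by rewrite setU0 uset e1 e2 mulr0.
  have u1 : u [set k1] (w - x k1) = (w == top_deg)%:R.
    have s1 : (w - x k1 == a1) = (w == top_deg) by rewrite a1E; apply: (inj_eq (addIr _)).
    by rewrite uset eqxx (negPf k12) s1 /=; case: eqP.
  have u2 : u [set k2] (w - x k2) = - (w == top_deg)%:R.
    have s2 : (w - x k2 == a2) = (w == top_deg) by rewrite a2E; apply: (inj_eq (addIr _)).
    by rewrite uset [k2 == k1]eq_sym (negPf k12) eqxx s2 /=; case: eqP; rewrite ?oppr0.
  by rewrite 2!ksign0 2!setU0 u1 u2 2!mul1r addr0 subrr.
(* Summing over the edges of one of the two disjoint monomials of this
   multidegree kills boundaries but not [v]. *)
have E : \sum_(k | left_edge k) u [set k] (top_deg - x k) = 1.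
  rewrite (bigD1 k1) //= uset -a1E !eqxx big1 ?addr0 // => k /andP[kT /negPf kk1].
  rewrite uset kk1 /=; have -> : (k == k2) = false by apply: contraNF nleft2 => /eqP <-.
  by [].
have : \sum_(k | left_edge k) bd x (chain x z) [set k] (top_deg - x k) = 0.
  (* Pairs of left edges cancel by antisymmetry of the Koszul signs; pairs with just one left edge
     vanish by [top_deg_cut]. *)
  pose F (k l : 'I_(Gt_nE t)) := (-1) ^+ (k < l)%N * chain x z (l |: [set k]) (top_deg - x k - x l).
  rewrite -[RHS](sum_antisym (P := left_edge) (F := F)) => [|k l _ _ kl]; last first.
    rewrite /F setUC (addrAC top_deg).
    have -> : (l < k)%N = ~~ (k < l)%N by move: kl; rewrite -val_eqE /=; lia.
    by case: (k < l)%N => /=; rewrite ?expr0 ?expr1; ring.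
  apply: eq_bigr => k kT; rewrite /bd (bigID left_edge) /= [X in _ + X]big1 ?addr0.
    apply: eq_big => [l|l]; first by rewrite inE andbC eq_sym.
    move=> /andP[lk _]; rewrite /F; congr (_ * _).
    by rewrite -(setU0 [set k]) ksign_setU1 ?inE // ksign0 mulr1.
  move=> l /andP[_ lT]; rewrite (supp_chain (@monoid_rho t)) ?mulr0 //.
  exact: top_deg_cut.
rewrite -(eq_bigr _ (fun k _ => vz [set k] (top_deg - x k))).
under eq_bigr => k _ do rewrite vu.
by rewrite E => /eqP; rewrite oner_eq0.
Qed.

End Quintic.

(* Regularity and degree of h *)
Local Close Scope ring_scope.

Theorem theorem3p9 (K : closedFieldType) (charK0 : [pchar K]%R =i pred0)
  (t : nat) (ht : (2 <= t)%N) :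
  reg_eq K (Gt_nE t) (Gt_nV t) (Gt_ends t) 4 /\
  hpoly_deg_eq K (Gt_nE t) (Gt_nV t) (Gt_ends t) (t + 3).
Proof.
have t0 : (0 < t)%N by lia.
have [ex [s [ls hs]]] := @node_monoid K t (@monoid_good t).
split; [split|].
- by exists 1%N; apply: betti14_neq0.
- move=> i [|d] //; apply: contraNT; rewrite -ltnNge => d4.
  apply/eqP; apply: (betti_eq0 (@Gt_ends_lt t) (@rho_edge_img t) (@wt_gen t)
    (@monoid_rho t) (@wt_rho t) (@rho_monoid_onto t)).
  exact: ex.
(* The t + 5 factors of the denominator modulo e1, and one more for the nonzerodivisor e1. *)
exists (t + 6)%N, (hpoly t); split=> [k|].
  rewrite -hs iter_diff_sum; apply: eq_bigr => l _.
  by rewrite (hilb_funE K (@Gt_ends_lt t) (@rho_edge_img t) (@monoid_rho t)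
    (@wt_rho t) (@rho_monoid_onto t) (ls _)).
by rewrite hpoly1_neq0 // size_hpoly // addnS.
Qed.
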